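(* Let $n\ge 1$ and let $L,L'$ be two $n$-component welded links (components ordered and oriented). Then: \begin{itemize} \item $L$ and $L'$ are equal up to $\mathrm{F}$ moves if and only if $\mathrm{vlk}_{ij}(L)=\mathrm{vlk}_{ij}(L')$ for all $i\ne j$ in $\{1,\dots,n\}$ (welded links up to $\mathrm{F}$ are classified by the virtual linking numbers); \item $L$ and $L'$ are equal up to $\mathrm{VC}$ moves if and only if $\mathrm{vlk}_{ij}(L)+\mathrm{vlk}_{ji}(L)=\mathrm{vlk}_{ij}(L')+\mathrm{vlk}_{ji}(L')$ for all $i\neq j$; \item $L$ and $L'$ are equal up to $\mathrm{CC}$ moves if and only if $\mathrm{vlk}_{ij}(L)-\mathrm{vlk}_{ji}(L)=\mathrm{vlk}_{ij}(L')-\mathrm{vlk}_{ji}(L')$ for all $i\neq j$; \item $L$ and $L'$ are equal up to $\mathrm{wBP}$ moves if and only if $\mathrm{vlk}^{\mathrm{mod}}_{i*}(L)=\mathrm{vlk}^{\mathrm{mod}}_{i*}(L')$ for all $i$ and $\mathrm{vlk}^{\mathrm{mod}}_{ij}(L)+\mathrm{vlk}^{\mathrm{mod}}_{ji}(L)=\mathrm{vlk}^{\mathrm{mod}}_{ij}(L')+\mathrm{vlk}^{\mathrm{mod}}_{ji}(L')$ for all $i\neq j$. \end{itemize}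
   Context: A Gauss diagram on $n$ ordered oriented circles is a finite set of triples $(t,h,\sigma)$, called arrows, where the tail $t$ and the head $h$ are points of the circles and $\sigma\in\{\pm1\}$ is a sign; all endpoints are distinct, and everything is considered up to orientation-preserving homeomorphisms of each circle. Two endpoints are adjacent if they lie on the same circle and bound an arc containing no other endpoint. A local move modifies arrows only on given disjoint portions of the circles containing no endpoints other than those mentioned; portions may lie on the same or on different components, in any order and with any orientation, and moves may be used in both directions. Welded Reidemeister moves: (R1) insert or delete an arrow of any sign whose two endpoints are adjacent; (R2) insert or delete two arrows with opposite signs whose tails are adjacent on one portion and whose heads are adjacent on another portion; (R3) given three disjoint portions $s_1,s_2,s_3$ containing exactly the endpoints of three arrows, one from $s_1$ to $s_2$ (sign $\varepsilon_{12}$), one from $s_2$ to $s_3$ (sign $\varepsilon_{23}$), one from $s_1$ to $s_3$ (sign $\varepsilon_{13}$), exchange the two endpoints on each of the three portions, provided $\varepsilon_{12}\eta_1\eta_2=\varepsilon_{23}\eta_2\eta_3=-\varepsilon_{13}\eta_1\eta_3$, where $\eta_k=+1$ if, along the orientation, the endpoint on $s_k$ of the arrow joining $s_k$ and $s_{k-1}$ precedes that of the arrow joining $s_k$ and $s_{k+1}$ (indices modulo 3), and $\eta_k=-1$ otherwise; (OC) exchange two adjacent tails. An $n$-component welded link is an equivalence class of Gauss diagrams on $n$ circles under these moves. (Equivalently: virtual link diagrams up to welded Reidemeister moves, with arrows corresponding to classical crossings, from the overpass to the underpass, labelled by the crossing sign.) Further moves. $\mathrm{F}$: exchange an adjacent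 tail and head of two distinct arrows. $\mathrm{VC}$ (virtual conjugation): reverse the direction of an arrow, keeping its sign. $\mathrm{CC}$ (crossing change): reverse the direction of an arrow and change its sign. $\mathrm{SR}$: change the sign of an arrow, keeping its direction. $\mathrm{BP}$ (unoriented band-pass): given four disjoint portions $s_1,s_2,s_3,s_4$ containing exactly the endpoints of four arrows, one from $s_i$ to $s_j$ with sign $\varepsilon_{ij}$ for each $i\in\{1,2\}$, $j\in\{3,4\}$, reverse the direction and change the sign of all four arrows, provided that $\varepsilon_{ij}\eta_i\eta_j$ takes the same value for all four pairs $(i,j)$, where for $i\in\{1,2\}$, $\eta_i=+1$ if the endpoint on $s_i$ of the arrow to $s_3$ precedes that of the arrow to $s_4$ along the orientation, and $-1$ otherwise, and for $j\in\{3,4\}$, $\eta_j=+1$ if the endpoint on $s_j$ of the arrow from $s_1$ precedes that of the arrow from $s_2$, and $-1$ otherwise. (This is: two parallel arcs passing over two parallel arcs are replaced by the same arcs with all four crossings changed.) $\mathrm{wBP}$ (welded band-pass): a $\mathrm{BP}$ move followed by an $\mathrm{SR}$ move on one of the four arrows involved. ''Equal up to $\mu$'' means related by a finite sequence of welded Reidemeister moves and $\mu$ moves. For $i\ne j$, $\mathrm{vlk}_{ij}\in\mathbb{Z}$ is the sum of the signs of all arrows with tail on component $i$ and head on component $j$ (an invariant of welded links); $\mathrm{vlk}_{ij}^{\mathrm{mod}}$ is its reduction modulo 2; $\mathrm{vlk}_{i*}^{\mathrm{mod}}$ is the reduction modulo 2 of $\sum_{k\ne i}\mathrm{vlk}_{ik}$.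 *)

(* Defs.v *)
From HB Require Import structures.
From mathcomp Require Import all_boot all_order all_algebra.
From mathcomp Require Import generic_quotient boolp.
From Stdlib Require Import Relation_Operators.

Set Implicit Arguments.
Unset Strict Implicit.
Unset Printing Implicit Defensive.

Import GRing.Theory.
Local Open Scope ring_scope.
Local Open Scope quotient_scope.

(* Signs are booleans, [true] being +1. *)
Definition sgn (s : bool) : int := if s then 1 else -1.

(* An arrow is a name together with a sign; the name only serves to match the
   tail of an arrow with its head. *)
Definition arrow : Type := (nat * bool)%type.

(* [true] marks tails and [false] marks heads. *)
Definition endpoint : Type := (bool * arrow)%type.

Definition tail_of (a : arrow) : endpoint := (true, a).
Definition head_of (a : arrow) : endpoint := (false, a).
Definition flip_sign (a : arrow) : arrow := (a.1, ~~ a.2).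

Definition tails (s : seq endpoint) : seq arrow := [seq e.2 | e <- s & e.1].
Definition heads (s : seq endpoint) : seq arrow := [seq e.2 | e <- s & ~~ e.1].

(* The word of a circle lists the endpoints met when travelling once along the
   circle from some base point that is not an endpoint.  Names are pairwise
   distinct, and each arrow has exactly one tail and one head, which carry the
   same sign. *)
Definition wf_words n (w : {ffun 'I_n -> seq endpoint}) : bool :=
  let s := flatten [seq w i | i <- enum 'I_n] in
  uniq [seq a.1 | a <- tails s] && perm_eq (tails s) (heads s).

Record gauss_diagram (n : nat) := GaussDiagram {
  words :> {ffun 'I_n -> seq endpoint};
  _ : wf_words words
}.

HB.instance Definition _ n := [isSub for @words n].
HB.instance Definition _ n := [Choice of gauss_diagram n by <:].

Definition rename (f : nat -> nat) (e : endpoint) : endpoint :=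
  (e.1, (f e.2.1, e.2.2)).

(* Gauss diagrams that agree up to an orientation-preserving homeomorphism of
   each circle: the names are immaterial, and so is each base point. *)
Definition isotopic n (D D' : gauss_diagram n) : Prop :=
  exists (f : nat -> nat) (r : 'I_n -> nat),
    injective f /\ forall i, D' i = rot (r i) (map (rename f) (D i)).

(* A template is a family of words in which some letters [inr k] stand for the
   k-th portion involved in a local move, and the letters [inl e] are the
   endpoints that the move leaves untouched. *)
Definition template (n : nat) : Type :=
  {ffun 'I_n -> seq (endpoint + nat)}.

Definition portions n (C : template n) : seq nat :=
  pmap (fun x => if x is inr k then Some k else None)
       (flatten [seq C i | i <- enum 'I_n]).

Definition fill n (C : template n) (u : seq (seq endpoint)) (i : 'I_n) :
    seq endpoint :=
  flatten [seq match x with inl e => [:: e] | inr k => nth [::] u k end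
          | x <- C i].

(* [M u v] reads: the contents u_0, ..., u_(k-1) of k disjoint portions, each
   read along the orientation of its circle, become v_0, ..., v_(k-1). *)
Definition rule : Type := seq (seq endpoint) -> seq (seq endpoint) -> Prop.

(* A portion that contains the base point of its circle is dealt with by first
   moving the base point, with [isotopic]. *)
Definition local_move n (M : rule) (D D' : gauss_diagram n) : Prop :=
  exists (C : template n) (u v : seq (seq endpoint)),
    [/\ M u v,
        size u = size v,
        perm_eq (portions C) (iota 0 (size u)),
        forall i, D i = fill C u i
      & forall i, D' i = fill C v i].

(* [ordered eta x y] is the portion with endpoints x and y in which x precedes
   y if eta is +1, and y precedes x if eta is -1. *)
Definition ordered (eta : bool) (x y : endpoint) : seq endpoint :=
  if eta then [:: x; y] else [:: y; x].

Inductive R1 : rule :=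
| R1_intro (a : arrow) (o : bool) :
    R1 [:: [::]] [:: ordered o (tail_of a) (head_of a)].

Inductive R2 : rule :=
| R2_intro (a b : arrow) (o o' : bool) :
    sgn a.2 = - sgn b.2 ->
    R2 [:: [::]; [::]]
       [:: ordered o (tail_of a) (tail_of b);
           ordered o' (head_of a) (head_of b)].

(* With indices modulo 3, the endpoint on s_k of the arrow joining s_k and
   s_(k-1) comes first in each [ordered]. *)
Inductive R3 : rule :=
| R3_intro (a12 a23 a13 : arrow) (eta1 eta2 eta3 : bool) :
    sgn a12.2 * sgn eta1 * sgn eta2 = sgn a23.2 * sgn eta2 * sgn eta3 ->
    sgn a23.2 * sgn eta2 * sgn eta3 = - (sgn a13.2 * sgn eta1 * sgn eta3) ->
    R3 [:: ordered eta1 (tail_of a13) (tail_of a12);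
           ordered eta2 (head_of a12) (tail_of a23);
           ordered eta3 (head_of a23) (head_of a13)]
       [:: ordered (~~ eta1) (tail_of a13) (tail_of a12);
           ordered (~~ eta2) (head_of a12) (tail_of a23);
           ordered (~~ eta3) (head_of a23) (head_of a13)].

Inductive OC : rule :=
| OC_intro (a b : arrow) :
    OC [:: [:: tail_of a; tail_of b]] [:: [:: tail_of b; tail_of a]].

Inductive F : rule :=
| F_intro (a b : arrow) :
    a != b -> F [:: [:: tail_of a; head_of b]] [:: [:: head_of b; tail_of a]].

Inductive VC : rule :=
| VC_intro (a : arrow) :
    VC [:: [:: tail_of a]; [:: head_of a]]
       [:: [:: head_of a]; [:: tail_of a]].

Inductive CC : rule :=
| CC_intro (a : arrow) :
    CC [:: [:: tail_of a]; [:: head_of a]]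
       [:: [:: head_of (flip_sign a)]; [:: tail_of (flip_sign a)]].

(* The parameter of [SR] is the arrow before the move, and that of [BP] lists
   the four arrows after the move. *)
Inductive SR (a : arrow) : rule :=
| SR_intro :
    SR a [:: [:: tail_of a]; [:: head_of a]]
         [:: [:: tail_of (flip_sign a)]; [:: head_of (flip_sign a)]].

Inductive BP : seq arrow -> rule :=
| BP_intro (a13 a14 a23 a24 : arrow) (eta1 eta2 eta3 eta4 : bool) :
    sgn a13.2 * sgn eta1 * sgn eta3 = sgn a14.2 * sgn eta1 * sgn eta4 ->
    sgn a14.2 * sgn eta1 * sgn eta4 = sgn a23.2 * sgn eta2 * sgn eta3 ->
    sgn a23.2 * sgn eta2 * sgn eta3 = sgn a24.2 * sgn eta2 * sgn eta4 ->
    let b13 := flip_sign a13 in let b14 := flip_sign a14 in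
    let b23 := flip_sign a23 in let b24 := flip_sign a24 in
    BP [:: b13; b14; b23; b24]
       [:: ordered eta1 (tail_of a13) (tail_of a14);
           ordered eta2 (tail_of a23) (tail_of a24);
           ordered eta3 (head_of a13) (head_of a23);
           ordered eta4 (head_of a14) (head_of a24)]
       [:: ordered eta1 (head_of b13) (head_of b14);
           ordered eta2 (head_of b23) (head_of b24);
           ordered eta3 (tail_of b13) (tail_of b23);
           ordered eta4 (tail_of b14) (tail_of b24)].

Definition F_move n (D D' : gauss_diagram n) : Prop := local_move F D D'.
Definition VC_move n (D D' : gauss_diagram n) : Prop := local_move VC D D'.
Definition CC_move n (D D' : gauss_diagram n) : Prop := local_move CC D D'.

Definition wBP_move n (D D' : gauss_diagram n) : Prop :=
  exists (A : seq arrow) (a : arrow) (D1 : gauss_diagram n),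
    [/\ local_move (BP A) D D1, a \in A & local_move (SR a) D1 D'].

Definition welded_move n (D D' : gauss_diagram n) : Prop :=
  [\/ isotopic D D', local_move R1 D D', local_move R2 D D'
    | local_move R3 D D' \/ local_move OC D D'].

(* Equivalence closures account for finite sequences of moves and for the use
   of moves in both directions. *)
Definition welded_eq n : gauss_diagram n -> gauss_diagram n -> Prop :=
  clos_refl_sym_trans _ (@welded_move n).

Definition welded_eqb n (D D' : gauss_diagram n) : bool := `[< welded_eq D D' >].

Lemma welded_eqb_refl n : reflexive (@welded_eqb n).
Proof. by move=> D; apply/asboolP; apply: rst_refl. Qed.

Lemma welded_eqb_sym n : symmetric (@welded_eqb n).
Proof. by move=> D D'; apply/asboolP/asboolP; apply: rst_sym. Qed.

Lemma welded_eqb_trans n : transitive (@welded_eqb n).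
Proof.
move=> D2 D1 D3 /asboolP h12 /asboolP h23.
by apply/asboolP; apply: rst_trans h12 h23.
Qed.

Canonical welded_equiv n :=
  EquivRel (@welded_eqb n) (@welded_eqb_refl n) (@welded_eqb_sym n)
    (@welded_eqb_trans n).

Definition welded_link (n : nat) : Type := {eq_quot (@welded_eqb n)}.

HB.instance Definition _ n : EqQuotient _ (@welded_eqb n) (welded_link n) :=
  EqQuotient.on (welded_link n).
HB.instance Definition _ n := Choice.on (welded_link n).

Definition link_of n (D : gauss_diagram n) : welded_link n :=
  \pi_(welded_link n) D.

Definition equal_up_to n (mu : gauss_diagram n -> gauss_diagram n -> Prop)
    (L L' : welded_link n) : Prop :=
  exists D D' : gauss_diagram n,
    [/\ link_of D = L, link_of D' = L'
      & clos_refl_sym_trans _ (fun E E' => welded_move E E' \/ mu E E') D D'].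

Definition diagram_vlk n (D : gauss_diagram n) (i j : 'I_n) : int :=
  \sum_(a <- tails (D i) | a \in heads (D j)) sgn a.2.

(* For i != j the value does not depend on the representative, since welded
   moves preserve [diagram_vlk D i j]; for i = j it does, by R1. *)
Definition vlk n (L : welded_link n) (i j : 'I_n) : int :=
  diagram_vlk (repr L) i j.

Definition vlk_mod n (L : welded_link n) (i j : 'I_n) : 'F_2 :=
  (vlk L i j)%:~R.

Definition vlk_star_mod n (L : welded_link n) (i : 'I_n) : 'F_2 :=
  (\sum_(k < n | k != i) vlk L i k)%:~R.

(* Main.v *)
Require Import Defs.
From mathcomp Require Import all_boot all_order all_algebra zify.
From mathcomp Require Import generic_quotient boolp.
From Stdlib Require Import Relation_Operators.

Set Implicit Arguments.
Unset Strict Implicit.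
Unset Printing Implicit Defensive.

Import Order.TTheory GRing.Theory Num.Theory.

(** The four relations have in common that, up to them, any two adjacent
    endpoints can be exchanged.  Tails commute by OC.  In an R3 configuration
    the three exchanges are those of two tails, of a tail and a head, and of two
    heads; two of them being available, R3 yields the third one, and the
    arrow that R3 asks for is supplied by R2 and taken back afterwards
    ([exchange_heads], [exchange_tails_heads]).  So it is enough to exchange
    either tails with heads or heads with heads.  The F move does the former by
    definition, and so do VC and CC, which turn the head into a tail
    ([exchange_reversal]).  For wBP, a band-pass on arrows that R2 creates
    leaves two parallel arrows of the same sign, which therefore cancel
    ([words_eq_pair]); a second band-pass then produces the commutator of two
    heads ([exchange_heads_wBP]).

    When all endpoints can be exchanged, a diagram is just a list of arrows, each
    with a sign, a source circle and a target circle ([words_eq_signed_ends]).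
    R1 deletes the arrows from a circle to itself, R2 deletes two arrows of
    opposite signs between the same circles in the same direction, and what is
    left is the off-diagonal part of the matrix of virtual linking numbers
    ([data_eq_lk]).  This is the case of F.

    In general, the integer matrices that can be added to the linking matrix
    without leaving a class form a group, the periods of the relation.  Writing
    E_ij for the elementary matrices, reversing one arrow shows that the
    E_ij - E_ji are periods for VC and the E_ij + E_ji for CC; off the diagonal,
    these generate all the matrices allowed by the invariant ([period_VC], [period_CC]).  For
    wBP, one band shows that the 2 E_ij and the symmetric matrices of triangles
    are periods.  Modulo 2, a difference of two linking matrices with the same
    invariants is the adjacency matrix of a graph with even degrees, that is, an
    element of the cycle space of the complete graph, which the triangles through
    one vertex generate ([period_wBP]).

    Conversely, a local move replaces a few arrows in a list by others, so that
    its effect on the linking matrix can be read off from the rule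
    ([vlk_change]), and the invariants are preserved by every move. *)

(** * Words and contexts *)

Definition move_rel (n : nat) : Type := gauss_diagram n -> gauss_diagram n -> Prop.

(** Contexts are handled word by word; the suffix w marks the operations on one
    word of a template. *)
Definition letter : Type := (endpoint + nat)%type.

Definition endpoints n (w : 'I_n -> seq endpoint) : seq endpoint :=
  flatten [seq w i | i <- enum 'I_n].

Definition names (s : seq endpoint) : seq nat := [seq a.1 | a <- tails s].

Definition balanced (s : seq endpoint) : bool := perm_eq (tails s) (heads s).

Definition valid (s : seq endpoint) : bool := uniq (names s) && balanced s.

Definition fillw (u : seq (seq endpoint)) (x : seq letter) : seq endpoint :=
  flatten [seq match y with inl e => [:: e] | inr k => nth [::] u k end
          | y <- x].

Definition portionsw (x : seq letter) : seq nat :=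
  pmap (fun y => if y is inr k then Some k else None) x.

Definition basew (x : seq letter) : seq endpoint :=
  pmap (fun y => if y is inl e then Some e else None) x.

Definition base n (C : template n) : seq endpoint :=
  basew (flatten [seq C i | i <- enum 'I_n]).

Definition has_portions n (C : template n) (m : nat) : bool :=
  perm_eq (portions C) (iota 0 m).

Lemma fillwE n (C : template n) u i : fill C u i = fillw u (C i).
Proof. by []. Qed.

Lemma fillw_cat u x y : fillw u (x ++ y) = fillw u x ++ fillw u y.
Proof. by rewrite /fillw map_cat flatten_cat. Qed.

Lemma fillw_inl u s : fillw u (map inl s) = s.
Proof. by elim: s => //= e s IH; rewrite /fillw /= in IH *; rewrite IH. Qed.

Lemma tails_cat s t : tails (s ++ t) = tails s ++ tails t.
Proof. by rewrite /tails filter_cat map_cat. Qed.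

Lemma heads_cat s t : heads (s ++ t) = heads s ++ heads t.
Proof. by rewrite /heads filter_cat map_cat. Qed.

Lemma names_cat s t : names (s ++ t) = names s ++ names t.
Proof. by rewrite /names tails_cat map_cat. Qed.

Lemma perm_tails s t : perm_eq s t -> perm_eq (tails s) (tails t).
Proof. by move=> st; apply/perm_map/perm_filter. Qed.

Lemma perm_heads s t : perm_eq s t -> perm_eq (heads s) (heads t).
Proof. by move=> st; apply/perm_map/perm_filter. Qed.

Lemma perm_names s t : perm_eq s t -> perm_eq (names s) (names t).
Proof. by move=> st; apply/perm_map/perm_tails. Qed.

Lemma perm_valid s t : perm_eq s t -> valid s = valid t.
Proof.
move=> st; rewrite /valid (perm_uniq (perm_names st)) /balanced.
by rewrite (permPl (perm_tails st)) (permPr (perm_heads st)).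
Qed.

Lemma mem_tails (a : arrow) s : (a \in tails s) = (tail_of a \in s).
Proof.
apply/mapP/idP => [[[b c]]|h]; first by rewrite mem_filter => /andP[/= -> ?] ->.
by exists (tail_of a); rewrite // mem_filter.
Qed.

Lemma mem_heads (a : arrow) s : (a \in heads s) = (head_of a \in s).
Proof.
apply/mapP/idP => [[[[] c]]|h]; rewrite ?mem_filter //=; first by move=> ? ->.
by exists (head_of a); rewrite // mem_filter.
Qed.

Lemma perm_endpoints n (w w' : 'I_n -> seq endpoint) :
  (forall i, perm_eq (w i) (w' i)) -> perm_eq (endpoints w) (endpoints w').
Proof.
by move=> h; rewrite /endpoints; elim: (enum _) => //= i s; apply: perm_cat.
Qed.

Lemma eq_endpoints n (w w' : 'I_n -> seq endpoint) : w =1 w' -> endpoints w = endpoints w'.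
Proof. by move=> h; rewrite /endpoints (eq_map h). Qed.

Lemma perm_fillw u x :
  perm_eq (fillw u x) (basew x ++ flatten [seq nth [::] u k | k <- portionsw x]).
Proof.
elim: x => [|[e|k] x IH] //=; first by rewrite /fillw /= perm_cons.
rewrite /fillw /= perm_sym perm_catCA perm_cat2l perm_sym; exact: IH.
Qed.

(** Validity does not depend on the order of the endpoints, so it can be decided
    on the letters of the context followed by those of the portions. *)
Lemma perm_fill n (C : template n) u : has_portions C (size u) ->
  perm_eq (endpoints (fill C u)) (base C ++ flatten u).
Proof.
move=> pC.
have -> : endpoints (fill C u) = fillw u (flatten [seq C i | i <- enum 'I_n]).
  rewrite /endpoints; elim: (enum _) => //= i s ->.
  by rewrite fillw_cat.
apply: (perm_trans (perm_fillw _ _)); rewrite perm_cat2l.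
have := perm_flatten (perm_map (nth [::] u) pC).
by rewrite map_nth_iota0 // take_size.
Qed.

(** [m] and its successors are available as names for new arrows. *)
Definition room (m : nat) (s : seq endpoint) : bool :=
  valid s && all (fun x => x < m) (names s).

Definition roomy n (C : template n) (m : nat) (u : seq (seq endpoint)) : bool :=
  room m (endpoints (fill C u)).

Lemma perm_room m s t : perm_eq s t -> room m s = room m t.
Proof. by move=> st; rewrite /room (perm_valid st) (perm_all _ (perm_names st)). Qed.

Lemma room_exists s : valid s -> exists m, room m s.
Proof.
move=> vs; exists (\max_(x <- names s) x).+1; rewrite /room vs /=.
by apply/allP => x xs; rewrite ltnS leq_bigmax_seq.
Qed.

Lemma valid_fill n (C : template n) u : has_portions C (size u) ->
  valid (endpoints (fill C u)) = valid (base C ++ flatten u).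
Proof. by move=> pC; apply/perm_valid/perm_fill. Qed.

Lemma roomy_fill n (C : template n) m u : has_portions C (size u) ->
  roomy C m u = room m (base C ++ flatten u).
Proof. by move=> pC; apply/perm_room/perm_fill. Qed.

Lemma roomy_perm n (C : template n) m u l : has_portions C (size u) ->
  perm_eq (flatten u) l -> roomy C m u = room m (l ++ base C).
Proof.
move=> pC ul; rewrite roomy_fill //; apply: perm_room.
by rewrite perm_catC (perm_catr _ ul).
Qed.

Lemma roomy_valid n (C : template n) m u : roomy C m u -> valid (endpoints (fill C u)).
Proof. by case/andP. Qed.

Lemma valid_arrow (a : arrow) s :
  valid (tail_of a :: head_of a :: s) = (a.1 \notin names s) && valid s.
Proof. by rewrite /valid /names /balanced /= perm_cons -andbA. Qed.

Lemma room_arrow m (a : arrow) s :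
  room m (tail_of a :: head_of a :: s) = [&& a.1 < m, a.1 \notin names s & room m s].
Proof.
rewrite /room valid_arrow -[names (_ :: _ :: s)]/(a.1 :: names s) [all _ (_ :: _)]/=.
by case: (a.1 < m); case: (a.1 \notin _); rewrite ?andbF.
Qed.

Lemma room_new m b s : room m s -> room m.+1 (tail_of (m, b) :: head_of (m, b) :: s).
Proof.
move=> /andP[vs /allP ms]; rewrite room_arrow ltnSn /room vs /=.
apply/andP; split; last by apply/allP => x /ms /= /ltnW.
by apply/negP => /ms; rewrite ltnn.
Qed.

(** * Equivalence of words *)

Definition moves_eq n (mu : move_rel n) :=
  clos_refl_sym_trans _ (fun E E' => welded_move E E' \/ mu E E').

(** Diagrams carry a proof of validity.  Stated on bare words, a chain of moves
    does not mention it; it is recovered at both ends by [words_eq_validl] and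
    [words_eq_validr]. *)
Definition words_eq n (mu : move_rel n)
    (w w' : 'I_n -> seq endpoint) : Prop :=
  exists D D' : gauss_diagram n, [/\ D =1 w, D' =1 w' & moves_eq mu D D'].

(** Relation [M] follows from the welded moves and [mu]. *)
Definition admits n (mu : move_rel n)
    (M : move_rel n) : Prop :=
  forall D D', M D D' -> moves_eq mu D D'.

Lemma diagram_eq n (D D' : gauss_diagram n) : D =1 D' -> D = D'.
Proof. by move=> /ffunP h; apply: val_inj. Qed.

Lemma diagram_valid n (D : gauss_diagram n) : valid (endpoints D).
Proof. by case: D. Qed.

Lemma diagram_of n (w : 'I_n -> seq endpoint) : valid (endpoints w) ->
  exists D : gauss_diagram n, D =1 w.
Proof.
move=> vw; have h : wf_words (finfun w).
  by rewrite /wf_words (eq_map (ffunE w)).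
by exists (GaussDiagram h) => i /=; rewrite ffunE.
Qed.

Lemma words_eq_validl n mu (w w' : 'I_n -> seq endpoint) :
  words_eq mu w w' -> valid (endpoints w).
Proof. by case=> D [D' [h _ _]]; rewrite -(eq_endpoints h) diagram_valid. Qed.

Lemma words_eq_sym n mu (w w' : 'I_n -> seq endpoint) :
  words_eq mu w w' -> words_eq mu w' w.
Proof. by case=> D [D' [h h' e]]; exists D', D; split=> //; apply: rst_sym. Qed.

Lemma words_eq_validr n mu (w w' : 'I_n -> seq endpoint) :
  words_eq mu w w' -> valid (endpoints w').
Proof. by move/words_eq_sym/words_eq_validl. Qed.

Lemma words_eq_trans n mu (w1 w2 w3 : 'I_n -> seq endpoint) :
  words_eq mu w1 w2 -> words_eq mu w2 w3 -> words_eq mu w1 w3.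
Proof.
case=> D1 [D2 [h1 h2 e]] [D2' [D3 [h2' h3 e']]]; exists D1, D3; split=> //.
apply: rst_trans e _; suff -> : D2 = D2' by [].
by apply: diagram_eq => i; rewrite h2 h2'.
Qed.

Lemma words_eq_refl n mu (w : 'I_n -> seq endpoint) :
  valid (endpoints w) -> words_eq mu w w.
Proof. by case/diagram_of=> D h; exists D, D; split=> //; apply: rst_refl. Qed.

Lemma eq_words_eq n mu (w1 w2 w1' w2' : 'I_n -> seq endpoint) : w1 =1 w1' -> w2 =1 w2' ->
  words_eq mu w1 w2 -> words_eq mu w1' w2'.
Proof.
move=> h1 h2 [D [D' [h h' e]]]; exists D, D'; split=> // i; first by rewrite h.
by rewrite h'.
Qed.

Lemma words_eq_of n (mu : move_rel n)
    (D D' : gauss_diagram n) (w w' : 'I_n -> seq endpoint) :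
  D =1 w -> D' =1 w' -> words_eq mu w w' -> moves_eq mu D D'.
Proof.
move=> h h' [E [E' [g g' e]]].
have -> : D = E by apply: diagram_eq => i; rewrite h g.
by have -> : D' = E' by apply: diagram_eq => i; rewrite h' g'.
Qed.

(** * Moves inside a context *)

(** A move is mostly applied to parts [p] of the portions of a context [C]: the
    portions are given by words [K] with holes, filled by [p].  Filling the
    context with [map (fillw p) K] is filling a finer context with [p]. *)

Definition substw (K : seq (seq letter)) (x : seq letter) : seq letter :=
  flatten [seq match y with inl e => [:: inl e] | inr k => nth [::] K k end
          | y <- x].

Definition subst_context n (K : seq (seq letter)) (C : template n) : template n :=
  [ffun i => substw K (C i)].

Lemma fillw_subst p K x : fillw p (substw K x) = fillw (map (fillw p) K) x.
Proof.
elim: x => //= y x IH; rewrite -[y :: x]cat1s.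
rewrite -[substw K (_ ++ _)]/((_ : seq letter) ++ substw K x) !fillw_cat IH; congr cat.
case: y => [e|k] //; rewrite /fillw /= ?cats0.
have [hk|hk] := ltnP k (size K); first by rewrite (nth_map [::]).
by rewrite !nth_default ?size_map.
Qed.

Lemma fill_subst n (C : template n) p K i :
  fill (subst_context K C) p i = fill C (map (fillw p) K) i.
Proof. by rewrite !fillwE ffunE fillw_subst. Qed.

Lemma portions_subst n (C : template n) K m : has_portions C (size K) ->
  perm_eq (flatten (map portionsw K)) (iota 0 m) -> has_portions (subst_context K C) m.
Proof.
move=> pC pK; rewrite /has_portions /portions.
have -> : flatten [seq subst_context K C i | i <- enum 'I_n] =
    substw K (flatten [seq C i | i <- enum 'I_n]).
  elim: (enum _) => //= i s ->; rewrite ffunE /substw map_cat flatten_cat.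
  by [].
rewrite -/(portionsw _).
have -> : forall x, portionsw (substw K x) =
    flatten [seq nth [::] (map portionsw K) k | k <- portionsw x].
  elim=> //= y x IH; rewrite -[portionsw _]/(portionsw ((_ : seq letter) ++ substw K x)).
  rewrite /portionsw pmap_cat -!/(portionsw _) IH.
  case: y => [e|k] //=; congr cat.
  have [hk|hk] := ltnP k (size K); first by rewrite (nth_map [::]).
  by rewrite !nth_default ?size_map.
apply: (perm_trans (perm_flatten (perm_map _ pC))).
by rewrite map_nth_iota0 ?size_map // -(size_map portionsw) take_size.
Qed.

Lemma local_moveI n (M : rule) (C : template n) K p q (D D' : gauss_diagram n) :
  M p q -> size p = size q -> has_portions C (size K) ->
  perm_eq (flatten (map portionsw K)) (iota 0 (size p)) ->
  D =1 fill C (map (fillw p) K) -> D' =1 fill C (map (fillw q) K) ->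
  local_move M D D'.
Proof.
move=> Mpq spq pC pK hD hD'; exists (subst_context K C), p, q; split=> //.
- exact: portions_subst pC pK.
- by move=> i; rewrite hD fill_subst.
- by move=> i; rewrite hD' fill_subst.
Qed.

Lemma words_eq_local n mu M (C : template n) K p q u v :
  admits mu (local_move M) -> M p q -> size p = size q ->
  has_portions C (size K) ->
  perm_eq (flatten (map portionsw K)) (iota 0 (size p)) ->
  u = map (fillw p) K -> v = map (fillw q) K ->
  valid (endpoints (fill C u)) -> valid (endpoints (fill C v)) ->
  words_eq mu (fill C u) (fill C v).
Proof.
move=> aM Mpq spq pC pK -> -> /diagram_of[D hD] /diagram_of[D' hD'].
exists D, D'; split=> //; apply: aM; exact: local_moveI Mpq spq pC pK hD hD'.
Qed.

Lemma perm_fillw_map (K : seq (seq letter)) p :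
  perm_eq (flatten (map portionsw K)) (iota 0 (size p)) ->
  perm_eq (flatten (map (fillw p) K)) (basew (flatten K) ++ flatten p).
Proof.
move=> pK; have -> : flatten (map (fillw p) K) = fillw p (flatten K).
  by elim: K {pK} => //= x K ->; rewrite fillw_cat.
apply: (perm_trans (perm_fillw _ _)); rewrite perm_cat2l.
have -> : portionsw (flatten K) = flatten (map portionsw K).
  by elim: K {pK} => //= x K <-; rewrite /portionsw pmap_cat.
have := perm_flatten (perm_map (nth [::] p) pK).
by rewrite map_nth_iota0 // take_size.
Qed.

Lemma roomy_map n (C : template n) m K p : has_portions C (size K) ->
  perm_eq (flatten (map portionsw K)) (iota 0 (size p)) ->
  roomy C m (map (fillw p) K) = room m (flatten p ++ base C ++ basew (flatten K)).
Proof.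
move=> pC pK; rewrite roomy_fill ?size_map //; apply: perm_room.
rewrite perm_sym perm_catC -catA perm_cat2l perm_sym; exact: perm_fillw_map.
Qed.

(** The steps of a chain of moves are written from left to right: each lemma
    whose name contains step reduces the equivalence of the current filling with
    [w] to that of the next filling. *)
Lemma local_step n mu M (C : template n) K p q m m' w :
  admits mu (local_move M) -> M p q -> size p = size q ->
  has_portions C (size K) ->
  perm_eq (flatten (map portionsw K)) (iota 0 (size p)) ->
  roomy C m (map (fillw p) K) -> roomy C m' (map (fillw q) K) ->
  words_eq mu (fill C (map (fillw q) K)) w ->
  words_eq mu (fill C (map (fillw p) K)) w.
Proof.
move=> aM Mpq spq pC pK rp rq; apply: words_eq_trans.
by apply: (words_eq_local aM Mpq spq pC pK) => //; [move: rp | move: rq];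
  apply: roomy_valid.
Qed.

Lemma local_step_back n mu M (C : template n) K p q m m' w :
  admits mu (local_move M) -> M q p -> size p = size q ->
  has_portions C (size K) ->
  perm_eq (flatten (map portionsw K)) (iota 0 (size p)) ->
  roomy C m (map (fillw p) K) -> roomy C m' (map (fillw q) K) ->
  words_eq mu (fill C (map (fillw q) K)) w ->
  words_eq mu (fill C (map (fillw p) K)) w.
Proof.
move=> aM Mqp spq pC pK rp rq; apply: words_eq_trans; apply: words_eq_sym.
have pK' : perm_eq (flatten (map portionsw K)) (iota 0 (size q)) by rewrite -spq.
by apply: (words_eq_local aM Mqp (esym spq) pC pK') => //; [move: rq | move: rp];
  apply: roomy_valid.
Qed.

Lemma admits_R1 n (mu : move_rel n) :
  admits mu (local_move R1).
Proof. by move=> D D' h; apply: rst_step; left; apply: Or42. Qed.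

Lemma admits_R2 n (mu : move_rel n) :
  admits mu (local_move R2).
Proof. by move=> D D' h; apply: rst_step; left; apply: Or43. Qed.

Lemma admits_R3 n (mu : move_rel n) :
  admits mu (local_move R3).
Proof. by move=> D D' h; apply: rst_step; left; apply: Or44; left. Qed.

Lemma admits_OC n (mu : move_rel n) :
  admits mu (local_move OC).
Proof. by move=> D D' h; apply: rst_step; left; apply: Or44; right. Qed.

(** * Exchanging adjacent endpoints *)

Definition exchangeable n (mu : move_rel n) (x y : endpoint) : Prop :=
  forall C : template n, has_portions C 1 ->
    valid (endpoints (fill C [:: [:: x; y]])) ->
    words_eq mu (fill C [:: [:: x; y]]) (fill C [:: [:: y; x]]).

Definition all_exchangeable n (mu : move_rel n) : Prop :=
  forall x y, exchangeable mu x y.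

Lemma exchangeable_sym n (mu : move_rel n) x y : exchangeable mu x y -> exchangeable mu y x.
Proof.
move=> exy C pC vyx; apply: words_eq_sym; apply: exy => //.
rewrite (perm_valid (t := endpoints (fill C [:: [:: y; x]]))) //.
apply: (perm_trans (perm_fill _)) => //.
rewrite perm_sym; apply: (perm_trans (perm_fill _)) => //.
by rewrite perm_cat2l /= (perm_catC [:: y] [:: x]).
Qed.

Lemma exchange_step n mu (C : template n) K x y m w :
  exchangeable mu x y ->
  has_portions C (size K) -> perm_eq (flatten (map portionsw K)) [:: 0] ->
  roomy C m (map (fillw [:: [:: x; y]]) K) ->
  (roomy C m (map (fillw [:: [:: y; x]]) K) ->
     words_eq mu (fill C (map (fillw [:: [:: y; x]]) K)) w) ->
  words_eq mu (fill C (map (fillw [:: [:: x; y]]) K)) w.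
Proof.
move=> exy pC pK rxy H; apply: (words_eq_trans _ (H _)).
  apply: (eq_words_eq (fill_subst C _ K) (fill_subst C _ K)).
  apply: exy; first exact: (portions_subst (m := 1) pC pK).
  by rewrite (eq_endpoints (fill_subst C _ K)) (roomy_valid rxy).
move: rxy; rewrite !roomy_map // (@perm_room m _ ([:: y; x] ++ base C ++ basew (flatten K))) //.
by rewrite perm_cat2r (perm_catC [:: x] [:: y]).
Qed.

Lemma reorder_step n mu (C : template n) K x y o o' m w :
  exchangeable mu x y ->
  has_portions C (size K) -> perm_eq (flatten (map portionsw K)) [:: 0] ->
  roomy C m (map (fillw [:: ordered o x y]) K) ->
  (roomy C m (map (fillw [:: ordered o' x y]) K) ->
     words_eq mu (fill C (map (fillw [:: ordered o' x y]) K)) w) ->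
  words_eq mu (fill C (map (fillw [:: ordered o x y]) K)) w.
Proof.
move=> exy pC pK; case: o o' => [] [] r H; try exact: H.
  exact: (exchange_step exy pC pK r H).
by apply: (exchange_step _ pC pK r H) => C' pC' vC'; apply: (exchangeable_sym exy).
Qed.

Lemma count_ordered P e x y : count P (ordered e x y) = P x + P y.
Proof. by case: e => /=; clear; lia. Qed.

Lemma perm_ordered e e' x y : perm_eq (ordered e x y) (ordered e' x y).
Proof. by apply/permP => P; rewrite !count_ordered. Qed.

(** The side conditions on signs, as identities between booleans: the product of
    two signs corresponds to the negated exclusive or. *)
Lemma R2_signs (a b : arrow) (o o' : bool) : a.2 = ~~ b.2 ->
  R2 [:: [::]; [::]] [:: ordered o (tail_of a) (tail_of b);
                         ordered o' (head_of a) (head_of b)].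
Proof. by move=> ab; apply: R2_intro; rewrite ab; case: (b.2). Qed.

Lemma R3_signs (a12 a23 a13 : arrow) (eta1 eta2 eta3 : bool) :
  a12.2 (+) eta1 = a23.2 (+) eta3 -> a23.2 (+) eta2 = ~~ (a13.2 (+) eta1) ->
  R3 [:: ordered eta1 (tail_of a13) (tail_of a12);
         ordered eta2 (head_of a12) (tail_of a23);
         ordered eta3 (head_of a23) (head_of a13)]
     [:: ordered (~~ eta1) (tail_of a13) (tail_of a12);
         ordered (~~ eta2) (head_of a12) (tail_of a23);
         ordered (~~ eta3) (head_of a23) (head_of a13)].
Proof.
move=> h h'; apply: R3_intro; move: h h'.
  by case: (a12.2) (a23.2) (a13.2) eta1 eta2 eta3 => [] [] [] [] [] [].
by case: (a12.2) (a23.2) (a13.2) eta1 eta2 eta3 => [] [] [] [] [] [].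
Qed.

Lemma R2_step n mu (C : template n) K m b b' o o' w :
  b = ~~ b' ->
  has_portions C (size K) -> perm_eq (flatten (map portionsw K)) (iota 0 2) ->
  roomy C m (map (fillw [:: [::]; [::]]) K) ->
  let c := (m, b) in let d := (m.+1, b') in
  let q := [:: ordered o (tail_of c) (tail_of d); ordered o' (head_of c) (head_of d)] in
  (roomy C m.+2 (map (fillw q) K) -> words_eq mu (fill C (map (fillw q) K)) w) ->
  words_eq mu (fill C (map (fillw [:: [::]; [::]]) K)) w.
Proof.
move=> bb pC pK r c d q H.
have r' : roomy C m.+2 (map (fillw q) K).
  move: r; rewrite !roomy_map // => /(room_new b) /(room_new b') /=.
  rewrite (@perm_room _ (_ ++ base C ++ _) (tail_of d :: head_of d :: tail_of c ::
    head_of c :: base C ++ basew (flatten K))) //.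
  by apply/permP => P; rewrite /q; case: (o); case: (o') => /=; clear; lia.
apply: (local_step (@admits_R2 n mu) (R2_signs o o' _) _ pC pK r r' (H r')) => //.
Qed.

Lemma R2_step_back n mu (C : template n) K m (c d : arrow) o o' w :
  c.2 = ~~ d.2 ->
  has_portions C (size K) -> perm_eq (flatten (map portionsw K)) (iota 0 2) ->
  let q := [:: ordered o (tail_of c) (tail_of d); ordered o' (head_of c) (head_of d)] in
  roomy C m (map (fillw q) K) ->
  (roomy C m (map (fillw [:: [::]; [::]]) K) ->
    words_eq mu (fill C (map (fillw [:: [::]; [::]]) K)) w) ->
  words_eq mu (fill C (map (fillw q) K)) w.
Proof.
move=> cd pC pK q r H.
have r' : roomy C m (map (fillw [:: [::]; [::]]) K).
  move: r; rewrite !roomy_map //=.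
  rewrite (@perm_room m _ (tail_of c :: head_of c :: tail_of d :: head_of d ::
     base C ++ basew (flatten K))); last first.
    by apply/permP => P; rewrite /q; case: (o); case: (o') => /=; clear; lia.
  by rewrite !room_arrow => /and5P[].
exact: (local_step_back (@admits_R2 n mu) (R2_signs o o' cd) _ pC pK r r' (H r')).
Qed.

Lemma exchange_tails n (mu : move_rel n) a b : exchangeable mu (tail_of a) (tail_of b).
Proof.
move=> C pC vC.
have pK : perm_eq (flatten (map portionsw [:: [:: inr 0]])) [:: 0] by [].
apply: (@words_eq_local _ _ _ _ [:: [:: inr 0]] _ _ _ _
  (@admits_OC n mu) (OC_intro a b)) => //.
rewrite (perm_valid (t := endpoints (fill C [:: [:: tail_of a; tail_of b]]))) //.
apply: (perm_trans (perm_fill _)) => //.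
rewrite perm_sym; apply: (perm_trans (perm_fill _)) => //.
by rewrite perm_cat2l /= (perm_catC [:: tail_of a] [:: tail_of b]).
Qed.

Lemma perm_flatten_upd (I : finType) (T : eqType) (f g : I -> seq T) (i : I) :
  (forall j, j != i -> f j = g j) ->
  exists r, perm_eq (flatten [seq f j | j <- enum I]) (f i ++ r) /\
            perm_eq (flatten [seq g j | j <- enum I]) (g i ++ r).
Proof.
move=> fg; exists (flatten [seq f j | j <- rem i (enum I)]).
have ii : i \in enum I by rewrite mem_enum.
split; rewrite (permPl (perm_flatten (perm_map _ (perm_to_rem ii)))) //=.
have -> : [seq g j | j <- rem i (enum I)] = [seq f j | j <- rem i (enum I)].
  apply/eq_in_map => j; rewrite (rem_filter _ (enum_uniq I)) mem_filter.
  by case/andP=> /= ji _; rewrite fg.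
by [].
Qed.

Lemma fillw_rcons u s x : (forall k, k \in portionsw x -> k < size u) ->
  fillw (rcons u s) x = fillw u x.
Proof.
elim: x => //= -[e|k] x IH lt; rewrite /fillw /= -/(fillw _ _) IH //.
  by rewrite nth_rcons lt // inE eqxx.
by move=> k' k'x; apply: lt; rewrite inE k'x orbT.
Qed.

(** An endpoint that the context leaves untouched can be made a portion of its
    own. *)
Lemma extract n (C : template n) m e : has_portions C m -> e \in base C ->
  exists C' : template n, has_portions C' m.+1 /\
    forall u, size u = m -> fill C' (rcons u [:: e]) =1 fill C u.
Proof.
move=> pC eC.
have {eC} [i eC] : exists i, inl e \in C i.
  suff : inl e \in flatten [seq C i | i <- enum 'I_n].
    by case/flattenP => _ /mapP[i _ ->]; exists i.
  move: eC; rewrite /base; elim: (flatten _) => //= [[e'|k] x IH]; rewrite !inE //=.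
  by case/predU1P=> [->|/IH->]; rewrite ?eqxx ?orbT.
have [x1 [x2 def]] : exists x1 x2, C i = x1 ++ inl e :: x2.
  by case/splitPr: eC => x1 x2; exists x1, x2.
pose C' : template n := [ffun j => if j == i then x1 ++ inr m :: x2 else C j].
have C'C j : j != i -> C' j = C j by move=> ji; rewrite ffunE (negbTE ji).
have [r [r1 r2]] := perm_flatten_upd C'C.
have pw x y : perm_eq x y -> perm_eq (portionsw x) (portionsw y) by exact: perm_pmap.
exists C'; split.
  rewrite /has_portions /portions (permPl (pw _ _ r1)).
  move: (pC); rewrite /has_portions /portions (permPl (pw _ _ r2)) ffunE eqxx def.
  rewrite /portionsw !pmap_cat /= -!/(portionsw _) -!catA => h.
  rewrite -[0 :: _]/(iota 0 m.+1) -[m.+1]addn1 iotaD add0n cats1.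
  rewrite perm_sym perm_rcons perm_sym.
  by rewrite cat_cons -cat1s perm_catCA /= perm_cons.
move=> u su j; rewrite !fillwE.
have lt_portion k : k \in portionsw (C j) -> k < size u.
  move=> kC; have : k \in portions C.
    rewrite /portions; have := mem_enum 'I_n j; elim: (enum _) => //= j' s IH.
    rewrite inE /portionsw pmap_cat mem_cat => /predU1P[<-|/IH->]; rewrite ?orbT //.
    by rewrite -/(portionsw _) kC.
  by rewrite (perm_mem pC) mem_iota su.
move: lt_portion; rewrite ffunE; case: eqP => [->|_ lt]; last exact: fillw_rcons.
rewrite def /portionsw pmap_cat /= -!/(portionsw _) => lt.
rewrite -[inr m :: x2]cat1s -[inl e :: x2]cat1s !fillw_cat.
rewrite (@fillw_rcons _ _ x1) ?(@fillw_rcons _ _ x2).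
- by rewrite [fillw _ [:: inr m]]/fillw /= -su nth_rcons ltnn eqxx.
- by move=> k kx; apply: lt; rewrite mem_cat kx orbT.
- by move=> k kx; apply: lt; rewrite mem_cat kx.
Qed.

Definition opposite (e : endpoint) : endpoint := (~~ e.1, e.2).

Lemma mem_opposite s e : balanced s -> e \in s -> opposite e \in s.
Proof.
move=> bs; have h a : ((true, a) \in s) = ((false, a) \in s).
  by rewrite -[(true, a)]/(tail_of a) -mem_tails (perm_mem bs) mem_heads.
by case: e => [[] a]; rewrite /opposite /= h.
Qed.

(** The exchange of [x] and [y] is proved in contexts where the opposite ends of
    their arrows are accessible as well. *)
Lemma exchangeable_complete n (mu : move_rel n) x y :
  x.2 != y.2 ->
  (forall (C : template n) m, has_portions C 3 ->
     roomy C m [:: [:: x; y]; [:: opposite x]; [:: opposite y]] ->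
     words_eq mu (fill C [:: [:: x; y]; [:: opposite x]; [:: opposite y]])
            (fill C [:: [:: y; x]; [:: opposite x]; [:: opposite y]])) ->
  exchangeable mu x y.
Proof.
move=> xy H C pC vC.
have bC : balanced (base C ++ [:: x; y]).
  by have := vC; rewrite (perm_valid (perm_fill _)) // => /andP[].
have oxC : opposite x \in base C.
  have : opposite x \in base C ++ [:: x; y].
    by apply: mem_opposite; rewrite // mem_cat !inE eqxx orbT.
  rewrite mem_cat !inE => /or3P[//|/eqP|/eqP] e.
    by case: x e {xy H vC bC} => [[] ?] [].
  by rewrite -e eqxx in xy.
have oyC : opposite y \in base C.
  have : opposite y \in base C ++ [:: x; y].
    by apply: mem_opposite; rewrite // mem_cat !inE eqxx !orbT.
  rewrite mem_cat !inE => /or3P[//|/eqP|/eqP] e.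
    by rewrite -e eqxx in xy.
  by case: y e {xy H vC bC} => [[] ?] [].
have [C1 [pC1 fC1]] := extract pC oxC.
have pb : perm_eq (base C) (opposite x :: base C1).
  have := perm_endpoints (fun i => perm_refl (fill C [:: [:: x; y]] i)).
  rewrite -{1}(eq_endpoints (fC1 [:: [:: x; y]] erefl)).
  rewrite (permPl (perm_fill _)) // (permPr (perm_fill _)) //= => h.
  by apply/permP => P; have /permP/(_ P) := h; rewrite !count_cat /=; clear; lia.
have oyC1 : opposite y \in base C1.
  have := oyC; rewrite (perm_mem pb) inE => /predU1P[|//] e.
  by case: e xy => _ ->; rewrite eqxx.
have [C2 [pC2 fC2]] := extract pC1 oyC1.
have f2 s i : fill C2 [:: s; [:: opposite x]; [:: opposite y]] i = fill C [:: s] i.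
  by rewrite -(fC1 [:: s]) // -(fC2 [:: s; [:: opposite x]]).
apply: (eq_words_eq (f2 _) (f2 _)).
have := vC; rewrite -(eq_endpoints (f2 _)) valid_fill //.
by case/room_exists => m r; apply: (H _ m) => //; rewrite roomy_fill.
Qed.

(** R1 deletes the arrow and inserts it again with its ends in the other order. *)
Lemma exchange_own n (mu : move_rel n) x :
  exchangeable mu x (opposite x).
Proof.
suff H a : exchangeable mu (tail_of a) (head_of a).
  by case: x => [[] a]; [|apply: exchangeable_sym]; apply: H.
move=> C pC vC; have pK : perm_eq (flatten (map portionsw [:: [:: inr 0]])) [:: 0] by [].
move: vC; rewrite valid_fill // => vC; have [m r] := room_exists vC.
have r0 : room m (base C).
  move: r; rewrite (@perm_room _ _ (tail_of a :: head_of a :: base C)).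
    by rewrite room_arrow => /and3P[].
  by rewrite perm_catC.
have r1 : roomy C m [:: [:: tail_of a; head_of a]] by rewrite roomy_fill.
have r0' : roomy C m [:: [::]] by rewrite roomy_fill // cats0.
have r' : roomy C m [:: [:: head_of a; tail_of a]].
  rewrite roomy_fill //; move: r; rewrite (@perm_room m _ (base C ++ [:: head_of a; tail_of a])) //.
  by rewrite perm_cat2l (perm_catC [:: tail_of a] [:: head_of a]).
apply: (local_step_back (K := [:: [:: inr 0]]) (@admits_R1 n mu) (R1_intro a true)
  _ pC pK r1 r0') => //.
apply: (local_step (K := [:: [:: inr 0]]) (@admits_R1 n mu) (R1_intro a false)
  _ pC pK r0' r') => //.
by apply: words_eq_refl; apply: (roomy_valid r').
Qed.

Definition exchanges_tails_heads n (mu : move_rel n) :=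
  forall a b, exchangeable mu (tail_of a) (head_of b).

Definition exchanges_heads n (mu : move_rel n) :=
  forall a b, exchangeable mu (head_of a) (head_of b).

Lemma R3_step n mu (C : template n) K m (a12 a23 a13 : arrow) (eta1 eta2 eta3 : bool) w :
  a12.2 (+) eta1 = a23.2 (+) eta3 -> a23.2 (+) eta2 = ~~ (a13.2 (+) eta1) ->
  has_portions C (size K) -> perm_eq (flatten (map portionsw K)) (iota 0 3) ->
  let p := [:: ordered eta1 (tail_of a13) (tail_of a12);
         ordered eta2 (head_of a12) (tail_of a23);
         ordered eta3 (head_of a23) (head_of a13)] in
  let q := [:: ordered (~~ eta1) (tail_of a13) (tail_of a12);
         ordered (~~ eta2) (head_of a12) (tail_of a23);
         ordered (~~ eta3) (head_of a23) (head_of a13)] in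
  roomy C m (map (fillw p) K) ->
  (roomy C m (map (fillw q) K) -> words_eq mu (fill C (map (fillw q) K)) w) ->
  words_eq mu (fill C (map (fillw p) K)) w.
Proof.
move=> s1 s2 pC pK p q r H.
have r' : roomy C m (map (fillw q) K).
  move: r; rewrite !roomy_map // (@perm_room _ _ (flatten q ++ base C ++ basew (flatten K))) //.
  rewrite perm_cat2r; apply/permP => P; rewrite /p /q.
  by case: (eta1); case: (eta2); case: (eta3) => /=; clear; lia.
by apply: (local_step (@admits_R3 n mu) (R3_signs s1 s2) _ pC pK r r' (H r')).
Qed.

(** R3 on [a], [b] and an auxiliary arrow [c] from the tail of [b] to the tail of
    [a]: apart from the two heads, it exchanges two tails, and a tail with a head,
    which can be undone.  The arrow [c] comes from R2, together with [d]. *)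
Lemma exchange_heads n (mu : move_rel n) :
  exchanges_tails_heads mu -> exchanges_heads mu.
Proof.
move=> th a b; have [->|ab] := eqVneq a b.
  by move=> C pC vC; apply: words_eq_refl.
apply: exchangeable_complete => //= C m pC r0.
(* The sign of c and the order o of the two tails solve the conditions of R3. *)
pose c : arrow := (m, ~~ b.2); pose d : arrow := (m.+1, b.2).
pose o := a.2 (+) b.2.
apply: (R2_step (m := m) (b := ~~ b.2) (b' := b.2) (o := true) (o' := false)
  (K := [:: map inl [:: head_of a; head_of b];
            [:: inr 1; inl (tail_of a)];
            [:: inl (tail_of b); inr 0]])) => // r1.
apply: (reorder_step (o := true) (o' := o)
  (K := [:: map inl [:: head_of a; head_of b];
            map inl [:: head_of d; head_of c; tail_of a];
            [:: inr 0; inl (tail_of d)]])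
  (@exchange_tails n mu b c) _ _ r1) => // r2.
apply: (R3_step (a12 := c) (a23 := a) (a13 := b)
  (eta1 := o) (eta2 := true) (eta3 := true)
  (K := [:: [:: inr 2];
            [:: inl (head_of d); inr 1];
            [:: inr 0; inl (tail_of d)]]) _ _ _ _ r2) => //.
  1,2: by rewrite /o /=; case: (a.2); case: (b.2).
move=> r3.
apply: (reorder_step (o := ~~ o) (o' := true)
  (K := [:: map inl [:: head_of b; head_of a];
            map inl [:: head_of d; tail_of a; head_of c];
            [:: inr 0; inl (tail_of d)]])
  (@exchange_tails n mu b c) _ _ r3) => // r4.
apply: (exchange_step
  (K := [:: map inl [:: head_of b; head_of a];
            [:: inl (head_of d); inr 0];
            map inl [:: tail_of b; tail_of c; tail_of d]])
  (th a c) _ _ r4) => // r5.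
apply: (R2_step_back (c := c) (d := d) (o := true) (o' := false)
  (K := [:: map inl [:: head_of b; head_of a];
            [:: inr 1; inl (tail_of a)];
            [:: inl (tail_of b); inr 0]]) _ _ _ r5) => // r6.
by apply: words_eq_refl; apply: (roomy_valid r6).
Qed.

(** The same argument, with the auxiliary arrow [c] from the tail of [a] to the
    head of [b]. *)
Lemma exchange_tails_heads n (mu : move_rel n) :
  exchanges_heads mu -> exchanges_tails_heads mu.
Proof.
move=> hh b a; apply: exchangeable_sym; have [->|ab] := eqVneq a b.
  exact: (@exchange_own n mu (head_of b)).
apply: exchangeable_complete => //= C m pC r0.
pose c : arrow := (m, ~~ b.2); pose d : arrow := (m.+1, b.2).
pose o := ~~ a.2 (+) b.2.
apply: (R2_step (m := m) (b := ~~ b.2) (b' := b.2) (o := false) (o' := true)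
  (K := [:: map inl [:: head_of a; tail_of b];
            [:: inr 0; inl (tail_of a)];
            [:: inl (head_of b); inr 1]])) => // r1.
apply: (reorder_step (o := true) (o' := o)
  (K := [:: map inl [:: head_of a; tail_of b];
            map inl [:: tail_of d; tail_of c; tail_of a];
            [:: inr 0; inl (head_of d)]])
  (hh b c) _ _ r1) => // r2.
apply: (R3_step (a12 := a) (a23 := b) (a13 := c)
  (eta1 := true) (eta2 := true) (eta3 := o)
  (K := [:: [:: inr 1];
            [:: inl (tail_of d); inr 0];
            [:: inr 2; inl (head_of d)]]) _ _ _ _ r2) => //.
  1,2: by rewrite /o /=; case: (a.2); case: (b.2).
move=> r3.
apply: (reorder_step (o := ~~ o) (o' := true)
  (K := [:: map inl [:: tail_of b; head_of a];
            map inl [:: tail_of d; tail_of a; tail_of c];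
            [:: inr 0; inl (head_of d)]])
  (hh b c) _ _ r3) => // r4.
apply: (exchange_step
  (K := [:: map inl [:: tail_of b; head_of a];
            [:: inl (tail_of d); inr 0];
            map inl [:: head_of b; head_of c; head_of d]])
  (@exchange_tails n mu a c) _ _ r4) => // r5.
apply: (R2_step_back (c := c) (d := d) (o := false) (o' := true)
  (K := [:: map inl [:: tail_of b; head_of a];
            [:: inr 0; inl (tail_of a)];
            [:: inl (head_of b); inr 1]]) _ _ _ r5) => // r6.
by apply: words_eq_refl; apply: (roomy_valid r6).
Qed.

Lemma exchange_all n (mu : move_rel n) :
  exchanges_tails_heads mu -> all_exchangeable mu.
Proof.
move=> th [[] a] [[] b]; first exact: exchange_tails.
- exact: th.
- by apply: exchangeable_sym; apply: th.
- exact: exchange_heads.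
Qed.

Lemma exchange_F n (mu : move_rel n) :
  admits mu (local_move F) -> exchanges_tails_heads mu.
Proof.
move=> aF a b; have [->|ab] := eqVneq a b; first exact: (@exchange_own n mu (tail_of b)).
move=> C pC vC; have [m r] := room_exists vC.
have r' : roomy C m [:: [:: head_of b; tail_of a]].
  move: r; rewrite -/(roomy _ _ _) !roomy_fill //.
  rewrite (@perm_room _ _ (base C ++ flatten [:: [:: head_of b; tail_of a]])) //.
  by rewrite perm_cat2l (perm_catC [:: tail_of a] [:: head_of b]).
apply: (local_step (K := [:: [:: inr 0]]) aF (F_intro ab) _ pC _ r r') => //.
by apply: words_eq_refl; apply: (roomy_valid r').
Qed.

(** Reversing an arrow turns its head into a tail, and tails commute.  Both VC
    and CC are of this form, with [f] the identity or the change of sign. *)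
Lemma exchange_reversal n (mu : move_rel n) M (f : arrow -> arrow) :
  admits mu (local_move M) ->
  (forall a, M [:: [:: tail_of a]; [:: head_of a]]
               [:: [:: head_of (f a)]; [:: tail_of (f a)]]) ->
  (forall a, (f a).1 = a.1) -> involutive f -> exchanges_tails_heads mu.
Proof.
move=> aM Mf f1 fK a b; have [->|ab] := eqVneq a b.
  exact: (@exchange_own n mu (tail_of b)).
apply: exchangeable_complete => //= C m pC r0.
have r c K : has_portions C (size K) -> perm_eq (flatten (map portionsw K)) (iota 0 2) ->
    roomy C m (map (fillw [:: [:: tail_of c]; [:: head_of c]]) K) ->
    roomy C m (map (fillw [:: [:: head_of (f c)]; [:: tail_of (f c)]]) K).
  move=> pC' pK; rewrite !roomy_map //= (@perm_room _ (head_of (f c) :: _)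
    (tail_of (f c) :: head_of (f c) :: base C ++ basew (flatten K))).
    by rewrite !room_arrow f1.
  by rewrite -cat1s -[tail_of _ :: _]cat1s perm_catCA.
have r1 := r b [:: [:: inl (tail_of a); inr 1]; [:: inl (head_of a)]; [:: inr 0]] pC erefl r0.
apply: (local_step (K := [:: [:: inl (tail_of a); inr 1]; [:: inl (head_of a)]; [:: inr 0]])
   aM (Mf b) _ _ _ r0 r1) => //.
apply: (exchange_step (K := [:: [:: inr 0]; [:: inl (head_of a)]; [:: inl (head_of (f b))]])
   (@exchange_tails n mu a (f b)) _ _ r1) => // r2.
have r3 := r (f b) [:: [:: inr 0; inl (tail_of a)]; [:: inl (head_of a)]; [:: inr 1]] pC erefl r2.
apply: (local_step (K := [:: [:: inr 0; inl (tail_of a)]; [:: inl (head_of a)]; [:: inr 1]])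
   aM (Mf (f b)) _ _ _ r2 r3) => //.
rewrite fK in r3 *; by apply: words_eq_refl; apply: (roomy_valid r3).
Qed.

(** * Band-passes *)
Lemma flip_signK : involutive flip_sign.
Proof. by case=> k s; rewrite /flip_sign /= negbK. Qed.

Lemma BP_signs (a13 a14 a23 a24 : arrow) (eta1 eta2 eta3 eta4 : bool) :
  a13.2 (+) (eta1 (+) eta3) = a14.2 (+) (eta1 (+) eta4) ->
  a14.2 (+) (eta1 (+) eta4) = a23.2 (+) (eta2 (+) eta3) ->
  a23.2 (+) (eta2 (+) eta3) = a24.2 (+) (eta2 (+) eta4) ->
  let b13 := flip_sign a13 in let b14 := flip_sign a14 in
  let b23 := flip_sign a23 in let b24 := flip_sign a24 in
  BP [:: b13; b14; b23; b24]
     [:: ordered eta1 (tail_of a13) (tail_of a14);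
         ordered eta2 (tail_of a23) (tail_of a24);
         ordered eta3 (head_of a13) (head_of a23);
         ordered eta4 (head_of a14) (head_of a24)]
     [:: ordered eta1 (head_of b13) (head_of b14);
         ordered eta2 (head_of b23) (head_of b24);
         ordered eta3 (tail_of b13) (tail_of b23);
         ordered eta4 (tail_of b14) (tail_of b24)].
Proof.
have sgn3 s e e' : (sgn s * sgn e * sgn e')%R = sgn (s (+) (e (+) e')).
  by case: s e e' => [] [] [].
by move=> h1 h2 h3; apply: BP_intro; rewrite !sgn3 ?h1 ?h2 ?h3.
Qed.

(** The sign that SR restores is that of the fourth arrow: it is reversed without
    change of sign, and the other three are reversed with a change of sign. *)
Lemma words_eq_wBP n (mu : move_rel n) (C : template n) m
    (b13 b14 b23 a24 : arrow) (eta1 eta2 eta3 eta4 : bool) :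
  admits mu (@wBP_move n) ->
  ~~ b13.2 (+) (eta1 (+) eta3) = ~~ b14.2 (+) (eta1 (+) eta4) ->
  ~~ b14.2 (+) (eta1 (+) eta4) = ~~ b23.2 (+) (eta2 (+) eta3) ->
  ~~ b23.2 (+) (eta2 (+) eta3) = a24.2 (+) (eta2 (+) eta4) ->
  let a13 := flip_sign b13 in let a14 := flip_sign b14 in
  let a23 := flip_sign b23 in
  let p := [:: ordered eta1 (tail_of a13) (tail_of a14);
               ordered eta2 (tail_of a23) (tail_of a24);
               ordered eta3 (head_of a13) (head_of a23);
               ordered eta4 (head_of a14) (head_of a24)] in
  let r := [:: ordered eta1 (head_of b13) (head_of b14);
               ordered eta2 (head_of b23) (head_of a24);
               ordered eta3 (tail_of b13) (tail_of b23);
               ordered eta4 (tail_of b14) (tail_of a24)] in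
  has_portions C 4 ->
  roomy C m r = roomy C m p /\ (roomy C m p -> words_eq mu (fill C p) (fill C r)).
Proof.
move=> aM h1 h2 h3 a13 a14 a23 p r pC; pose b24 := flip_sign a24.
pose q := [:: ordered eta1 (head_of b13) (head_of b14);
              ordered eta2 (head_of b23) (head_of b24);
              ordered eta3 (tail_of b13) (tail_of b23);
              ordered eta4 (tail_of b14) (tail_of b24)].
have {h1 h2 h3} Mpq : BP [:: b13; b14; b23; b24] p q.
  by have := @BP_signs a13 a14 a23 a24 _ _ _ _ h1 h2 h3; rewrite /= !flip_signK.
have perm4 u (c13 c14 c23 c24 : arrow) :
    perm_eq (flatten u) [:: tail_of c13; head_of c13; tail_of c14; head_of c14;
       tail_of c23; head_of c23; tail_of c24; head_of c24] ->
    size u = 4 ->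
    roomy C m u = room m [:: tail_of c13, head_of c13, tail_of c14, head_of c14,
       tail_of c23, head_of c23, tail_of c24, head_of c24 & base C].
  by move=> pu su; rewrite (roomy_perm _ _ pu) ?su.
have rq : roomy C m q = roomy C m p.
  rewrite (perm4 q b13 b14 b23 b24) ?(perm4 p a13 a14 a23 a24) //.
  - by rewrite !room_arrow.
  - by apply/permP => P; rewrite /p /= !count_cat !count_ordered /=; clear; lia.
  by apply/permP => P; rewrite /q /= !count_cat !count_ordered /=; clear; lia.
have rr : roomy C m r = roomy C m p.
  rewrite (perm4 p a13 a14 a23 a24) ?(perm4 r b13 b14 b23 a24) //.
  - by rewrite !room_arrow.
  - by apply/permP => P; rewrite /r /= !count_cat !count_ordered /=; clear; lia.
  by apply/permP => P; rewrite /p /= !count_cat !count_ordered /=; clear; lia.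
split=> // rp; move: rr rq; rewrite rp => rr rq; have [D hD] := diagram_of (roomy_valid rp).
have [D1 hD1] := diagram_of (roomy_valid rq).
have [D' hD'] := diagram_of (roomy_valid rr).
exists D, D'; split=> //; apply: aM; exists [:: b13; b14; b23; b24], b24, D1.
split; last 1 first.
- pose K := [:: map inl (ordered eta1 (head_of b13) (head_of b14));
      if eta2 then [:: inl (head_of b23); inr 1] else [:: inr 1; inl (head_of b23)];
      map inl (ordered eta3 (tail_of b13) (tail_of b23));
      if eta4 then [:: inl (tail_of b14); inr 0] else [:: inr 0; inl (tail_of b14)]]
    : seq (seq letter).
  have fK c : map (fillw [:: [:: tail_of c]; [:: head_of c]]) K =
     [:: ordered eta1 (head_of b13) (head_of b14);
               ordered eta2 (head_of b23) (head_of c);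
               ordered eta3 (tail_of b13) (tail_of b23);
               ordered eta4 (tail_of b14) (tail_of c)].
    by rewrite /K; case: (eta1); case: (eta2); case: (eta3); case: (eta4).
  apply: (local_moveI (C := C) (K := K) (SR_intro b24)) => //.
  + by rewrite /K; case: (eta1); case: (eta2); case: (eta3); case: (eta4).
  + by move=> i; rewrite fK hD1.
  + by move=> i; rewrite fK hD' flip_signK.
- by exists C, p, q; split.
- by rewrite !inE eqxx !orbT.
Qed.

Lemma wBP_step n (mu : move_rel n) (C : template n) K m
    (b13 b14 b23 a24 : arrow) (eta1 eta2 eta3 eta4 : bool) w :
  admits mu (@wBP_move n) ->
  ~~ b13.2 (+) (eta1 (+) eta3) = ~~ b14.2 (+) (eta1 (+) eta4) ->
  ~~ b14.2 (+) (eta1 (+) eta4) = ~~ b23.2 (+) (eta2 (+) eta3) ->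
  ~~ b23.2 (+) (eta2 (+) eta3) = a24.2 (+) (eta2 (+) eta4) ->
  let a13 := flip_sign b13 in let a14 := flip_sign b14 in
  let a23 := flip_sign b23 in
  let p := [:: ordered eta1 (tail_of a13) (tail_of a14);
               ordered eta2 (tail_of a23) (tail_of a24);
               ordered eta3 (head_of a13) (head_of a23);
               ordered eta4 (head_of a14) (head_of a24)] in
  let r := [:: ordered eta1 (head_of b13) (head_of b14);
               ordered eta2 (head_of b23) (head_of a24);
               ordered eta3 (tail_of b13) (tail_of b23);
               ordered eta4 (tail_of b14) (tail_of a24)] in
  has_portions C (size K) -> perm_eq (flatten (map portionsw K)) (iota 0 4) ->
  (roomy C m (map (fillw p) K) ->
    (roomy C m (map (fillw r) K) -> words_eq mu (fill C (map (fillw r) K)) w) ->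
    words_eq mu (fill C (map (fillw p) K)) w) /\
  (roomy C m (map (fillw r) K) ->
    (roomy C m (map (fillw p) K) -> words_eq mu (fill C (map (fillw p) K)) w) ->
    words_eq mu (fill C (map (fillw r) K)) w).
Proof.
move=> aM h1 h2 h3 a13 a14 a23 p r pC pK.
have rE u : roomy (subst_context K C) m u = roomy C m (map (fillw u) K).
  by rewrite /roomy (eq_endpoints (fill_subst C u K)).
have [rr H] := words_eq_wBP m aM h1 h2 h3 (portions_subst pC pK).
rewrite -!rE rr; split=> rp w'.
  apply: words_eq_trans (w' rp).
  by apply: (eq_words_eq (fill_subst C _ K) (fill_subst C _ K)); apply: H.
apply: words_eq_trans (w' rp); apply: words_eq_sym.
by apply: (eq_words_eq (fill_subst C _ K) (fill_subst C _ K)); apply: H.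
Qed.

(** Two parallel arrows cancel whatever their signs.  If the signs agree, R2
    inserts a pair [p], [q] between the two tails and beside the two heads, so
    that tails and heads form a band; after a band-pass, [p] and [q] are still
    opposite, but [x] and [y] have become opposite too, because of SR. *)
Lemma words_eq_pair n (mu : move_rel n) (C : template n) m (x y : arrow) :
  admits mu (@wBP_move n) -> has_portions C 2 ->
  let u := [:: [:: tail_of x; tail_of y]; [:: head_of x; head_of y]] in
  roomy C m u -> words_eq mu (fill C u) (fill C [:: [::]; [::]]).
Proof.
move=> aM pC u r0; have [xy|xy] := eqVneq x.2 (~~ y.2).
  apply: (R2_step_back (K := [:: [:: inr 0]; [:: inr 1]]) (o := true) (o' := true)
    xy pC _ r0) => // r1.
  by apply: words_eq_refl; apply: (roomy_valid r1).
have {}xy : x.2 = y.2 by move: xy; case: (x.2); case: (y.2).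
pose p : arrow := (m, x.2); pose q : arrow := (m.+1, ~~ x.2).
apply: (R2_step (m := m) (b := x.2) (b' := ~~ x.2) (o := true) (o' := true)
  (K := [:: [:: inl (tail_of x); inr 0; inl (tail_of y)];
            inr 1 :: map inl [:: head_of x; head_of y]])) => //.
  by rewrite negbK.
move=> r1.
refine (proj2 (@wBP_step n mu C [:: [:: inr 2; inr 3]; [:: inr 0; inr 1]] m.+2
  p q x y true true false true _ aM _ _ _ pC isT) r1 _).
1-3: by rewrite /= ?xy; case: (y.2).
move=> r2.
apply: (R2_step_back (c := flip_sign p) (d := flip_sign q) (o := true) (o' := true)
  (K := [:: [:: inl (head_of (flip_sign x)); inr 1; inl (head_of y)];
            inr 0 :: map inl [:: tail_of (flip_sign x); tail_of y]])
  _ _ _ r2) => //=.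
  by rewrite !negbK.
move=> r3.
apply: (R2_step_back (c := flip_sign x) (d := y) (o := true) (o' := true)
  (K := [:: [:: inr 1]; [:: inr 0]]) _ _ _ r3) => //; first by rewrite /= xy.
by move=> r4; apply: words_eq_refl; apply: (roomy_valid r4).
Qed.

Lemma pair_step_back n (mu : move_rel n) (C : template n) K m
    (x y : arrow) w :
  admits mu (@wBP_move n) ->
  has_portions C (size K) -> perm_eq (flatten (map portionsw K)) (iota 0 2) ->
  let u := [:: [:: tail_of x; tail_of y]; [:: head_of x; head_of y]] in
  roomy C m (map (fillw u) K) ->
  (roomy C m (map (fillw [:: [::]; [::]]) K) ->
     words_eq mu (fill C (map (fillw [:: [::]; [::]]) K)) w) ->
  words_eq mu (fill C (map (fillw u) K)) w.
Proof.
move=> aM pC pK u r0 H.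
have r' : roomy C m (map (fillw [:: [::]; [::]]) K).
  move: r0; rewrite !roomy_map //=.
  rewrite (@perm_room m _ (tail_of x :: head_of x :: tail_of y :: head_of y ::
     base C ++ basew (flatten K))); last first.
    by apply/permP => P /=; clear; lia.
  by rewrite !room_arrow => /and5P[].
apply: words_eq_trans (H r').
apply: (eq_words_eq (fill_subst C _ K) (fill_subst C _ K)).
apply: (words_eq_pair (m := m) aM (portions_subst pC pK)).
by rewrite /roomy (eq_endpoints (fill_subst C _ K)).
Qed.

Lemma pair_step n (mu : move_rel n) (C : template n) K m
    b b' w :
  admits mu (@wBP_move n) ->
  has_portions C (size K) -> perm_eq (flatten (map portionsw K)) (iota 0 2) ->
  let x := (m, b) in let y := (m.+1, b') in
  let u := [:: [:: tail_of x; tail_of y]; [:: head_of x; head_of y]] in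
  roomy C m (map (fillw [:: [::]; [::]]) K) ->
  (roomy C m.+2 (map (fillw u) K) -> words_eq mu (fill C (map (fillw u) K)) w) ->
  words_eq mu (fill C (map (fillw [:: [::]; [::]]) K)) w.
Proof.
move=> aM pC pK x y u r0 H.
have r' : roomy C m.+2 (map (fillw u) K).
  move: r0; rewrite !roomy_map // => /(room_new b) /(room_new b') /=.
  rewrite -/x -/y (@perm_room m.+2 (tail_of y :: _) (tail_of x :: tail_of y ::
     head_of x :: head_of y :: base C ++ basew (flatten K))) //.
  by apply/permP => P /=; clear; lia.
apply: words_eq_trans (H r'); apply: words_eq_sym.
apply: (pair_step_back aM pC pK r') => r''.
by apply: words_eq_refl; apply: (roomy_valid r'').
Qed.

(** An arrow can change its name and its sign at the same time: with a third
    arrow [z] between [x] and [y], one can cancel [z] with either of them. *)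
Lemma replace_step n (mu : move_rel n) (C : template n) K m
    (x y : arrow) w :
  admits mu (@wBP_move n) -> x.1 != y.1 ->
  has_portions C (size K) -> perm_eq (flatten (map portionsw K)) (iota 0 2) ->
  roomy C m (map (fillw [:: [:: tail_of x]; [:: head_of x]]) K) ->
  roomy C m (map (fillw [:: [:: tail_of y]; [:: head_of y]]) K) ->
  words_eq mu (fill C (map (fillw [:: [:: tail_of y]; [:: head_of y]]) K)) w ->
  words_eq mu (fill C (map (fillw [:: [:: tail_of x]; [:: head_of x]]) K)) w.
Proof.
move=> aM xy pC pK rx ry; apply: words_eq_trans.
have pC' := portions_subst (m := 2) pC pK.
move: rx ry; rewrite /roomy -!(eq_endpoints (fill_subst C _ K)) -!/(roomy _ _ _) => rx ry.
apply: (eq_words_eq (fill_subst C _ K) (fill_subst C _ K)).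
move: (subst_context K C) pC' rx ry => {pC pK w}C pC rx ry.
pose z : arrow := (m, true).
pose u3 := [:: [:: tail_of x; tail_of z; tail_of y];
               [:: head_of x; head_of z; head_of y]].
have r3 : roomy C m.+1 u3.
  have rE v : roomy C m [:: [:: tail_of v]; [:: head_of v]] =
      room m [:: tail_of v, head_of v & base C].
    by rewrite (@roomy_perm _ C m _ [:: tail_of v; head_of v]) //= perm_refl.
  move: rx ry; rewrite !rE.
  rewrite !room_arrow => /and3P[xm xC _] /and3P[ym yC vC].
  have pu3 : perm_eq (flatten u3) [:: tail_of z; head_of z; tail_of x; head_of x;
      tail_of y; head_of y].
    by apply/permP => P /=; clear; lia.
  rewrite (roomy_perm _ _ pu3) //.
  by apply: room_new; rewrite !room_arrow xm ym vC yC !andbT /names /= inE negb_or xy.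
apply: (@words_eq_trans _ _ _ (fill C u3)).
  apply: words_eq_sym; apply: (pair_step_back (x := z) (y := y)
    (K := [:: [:: inl (tail_of x); inr 0]; [:: inl (head_of x); inr 1]])
    aM _ _ r3) => // r4.
  by apply: words_eq_refl; apply: (roomy_valid r4).
apply: (pair_step_back (x := x) (y := z)
  (K := [:: [:: inr 0; inl (tail_of y)]; [:: inr 1; inl (head_of y)]])
  aM _ _ r3) => // r4.
by apply: words_eq_refl; apply: (roomy_valid r4).
Qed.

(** Beside the heads of [a] and [b], insert the tails of two cancelling arrows
    [y1], [y2] towards the tail of [b] and of two cancelling arrows [x1], [x2]
    towards the tail of [a], in the order y1 x1 y2 x2, which the commutation of
    tails permits.  A band-pass turns them into heads, so that the word reads
    a b y1 x1 y2 x2: cancel b with y1, then a with x1, and the heads of y2 and x2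
    remain, in the exchanged order. *)
Lemma exchange_heads_wBP n (mu : move_rel n) :
  admits mu (@wBP_move n) -> exchanges_heads mu.
Proof.
move=> aM a b; have [->|ab] := eqVneq a b.
  by move=> C pC vC; apply: words_eq_refl.
apply: exchangeable_complete => // C m pC r0.
rewrite -[opposite (head_of a)]/(tail_of a) -[opposite (head_of b)]/(tail_of b) in r0 *.
pose y1 := (m, true) : arrow; pose y2 := (m.+1, true) : arrow.
pose x1 := (m.+2, true) : arrow; pose x2 := (m.+3, true) : arrow.
apply: (pair_step (m := m) (b := true) (b' := true)
  (K := [:: [:: inl (head_of a); inl (head_of b); inr 0];
            [:: inl (tail_of a)];
            [:: inl (tail_of b); inr 1]]) aM _ _ r0) => // r1.
apply: (pair_step (b := true) (b' := true)
  (K := [:: [:: inl (head_of a); inl (head_of b);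
               inl (tail_of y1); inr 0; inl (tail_of y2)];
            [:: inl (tail_of a); inr 1];
            map inl [:: tail_of b; head_of y1; head_of y2]]) aM _ _ r1) => // r2.
apply: (exchange_step
  (K := [:: [:: inl (head_of a); inl (head_of b);
               inl (tail_of y1); inl (tail_of x1); inr 0];
            map inl [:: tail_of a; head_of x1; head_of x2];
            map inl [:: tail_of b; head_of y1; head_of y2]])
  (@exchange_tails n mu x2 y2) _ _ r2) => // r3.
refine (proj1 (@wBP_step n mu C
  [:: [:: inl (head_of a); inl (head_of b); inr 0; inr 1];
      [:: inl (tail_of a); inr 3];
      [:: inl (tail_of b); inr 2]] m.+4
  (flip_sign y1) (flip_sign x1) (flip_sign y2) x2 true true true true
  _ aM _ _ _ pC isT) r3 _) => // r4.
apply: (pair_step_back (x := b) (y := flip_sign y1)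
  (K := [:: [:: inl (head_of a); inr 1; inl (head_of (flip_sign x1));
               inl (head_of (flip_sign y2)); inl (head_of x2)];
            map inl [:: tail_of a; tail_of (flip_sign x1); tail_of x2];
            [:: inr 0; inl (tail_of (flip_sign y2))]])
  aM _ _ r4) => // r5.
apply: (pair_step_back (x := a) (y := flip_sign x1)
  (K := [:: [:: inr 1; inl (head_of (flip_sign y2)); inl (head_of x2)];
            [:: inr 0; inl (tail_of x2)];
            [:: inl (tail_of (flip_sign y2))]])
  aM _ _ r5) => // r6.
(* The names a and b are free again, and replace those of x2 and y2. *)
have roomE k u : perm_eq (flatten u) [:: tail_of b; head_of b; tail_of a; head_of a] ->
    size u = 3 ->
    roomy C k u = room k [:: tail_of b, head_of b, tail_of a, head_of a & base C].
  by move=> pu su; rewrite (roomy_perm _ _ pu) ?su.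
have [bm am bB aB [ba vB mB]] : [/\ b.1 < m, a.1 < m, b.1 \notin names (base C),
    a.1 \notin names (base C) & [/\ b.1 != a.1, valid (base C) &
    forall x, x \in names (base C) -> x < m]].
  move: r0; rewrite roomE //; last by apply/permP => P /=; clear; lia.
  rewrite !room_arrow /names /= inE negb_or -!/(names _).
  by case/and5P=> ? /andP[? ?] ? ? /andP[? /allP ?].
have room2 (x y : arrow) : x.1 < m.+4 -> y.1 < m.+4 -> x.1 != y.1 ->
    x.1 \notin names (base C) -> y.1 \notin names (base C) ->
    roomy C m.+4 [:: [:: head_of y; head_of x]; [:: tail_of x]; [:: tail_of y]].
  move=> xm ym xy xB yB.
  rewrite (@roomy_perm _ _ _ _ [:: tail_of x; head_of x; tail_of y; head_of y]) //; last first.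
    by apply/permP => P /=; clear; lia.
  rewrite !room_arrow xm ym yB /room vB ?andbT /names /= inE negb_or xy xB /=.
  by apply/allP => k /mB km; clear -km; lia.
have new k : m <= k -> k \notin names (base C).
  by move=> mk; apply/negP => /mB; rewrite ltnNge mk.
have lt4 k : k < m -> k < m.+4 by clear; lia.
have ne k j : k < m -> m <= j -> k != j by clear; lia.
have le3 : m <= x2.1 by rewrite /=; clear; lia.
have le1 : m <= (flip_sign y2).1 by rewrite /=; clear; lia.
have r7 : roomy C m.+4 [:: [:: head_of b; head_of x2]; [:: tail_of x2]; [:: tail_of b]].
  apply: room2; [exact: leqnn | exact: lt4 | by rewrite eq_sym ne | exact: new | exact: bB].
apply: (replace_step (x := flip_sign y2) (y := b) (K := [:: [:: inr 1; inl (head_of x2)];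
  [:: inl (tail_of x2)]; [:: inr 0]]) aM _ pC _ r6 r7) => //.
  by rewrite eq_sym ne.
have r8 : roomy C m.+4 [:: [:: head_of b; head_of a]; [:: tail_of a]; [:: tail_of b]].
  by apply: room2 => //; [exact: lt4 | exact: lt4 | rewrite eq_sym].
apply: (replace_step (x := x2) (y := a) (K := [:: [:: inl (head_of b); inr 1];
  [:: inr 0]; [:: inl (tail_of b)]]) aM _ pC _ r7 r8) => //.
  by rewrite eq_sym ne.
by apply: words_eq_refl; apply: (roomy_valid r8).
Qed.

(** * Rearranging the endpoints *)
Lemma portionsw_cat x y : portionsw (x ++ y) = portionsw x ++ portionsw y.
Proof. exact: pmap_cat. Qed.

Lemma portionsw_flatten ss : portionsw (flatten ss) = flatten (map portionsw ss).
Proof. by elim: ss => //= s ss IH; rewrite portionsw_cat IH. Qed.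

Lemma portionsw_inl s : portionsw (map inl s) = [::].
Proof. by elim: s. Qed.

Lemma portionsw_inr s : portionsw (map inr s) = s.
Proof. by elim: s => //= k s ->. Qed.

(** The contents of the portions lying on circle [c], portion [k] lying on circle
    [loc k]. *)
Definition placed n (loc : nat -> 'I_n) m (u : seq (seq endpoint)) (c : 'I_n) :
    seq endpoint :=
  flatten [seq nth [::] u k | k <- iota 0 m & loc k == c].

Definition front_context n (loc : nat -> 'I_n) m (w : 'I_n -> seq endpoint) : template n :=
  [ffun c => map inr [seq k <- iota 0 m | loc k == c] ++ map inl (w c)].

Lemma fill_front n (loc : nat -> 'I_n) m w u c :
  fill (front_context loc m w) u c = placed loc m u c ++ w c.
Proof.
rewrite fillwE ffunE fillw_cat fillw_inl /placed; congr cat.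
by elim: (filter _ _) => //= k s IH; rewrite -IH /fillw.
Qed.

Lemma perm_distribute (I : finType) (T : eqType) (f : T -> I) (s : seq T) :
  perm_eq (flatten [seq [seq x <- s | f x == i] | i <- enum I]) s.
Proof.
elim: s => [|x s IH] /=; first by elim: (enum I).
have h j : j != f x -> (if f x == j then x :: [seq x <- s | f x == j]
    else [seq x <- s | f x == j]) = [seq x <- s | f x == j].
  by rewrite eq_sym => /negbTE ->.
have [r [h1 h2]] := perm_flatten_upd h.
by rewrite (permPl h1) eqxx /= perm_cons -(permPl h2).
Qed.

Lemma front_portions n (loc : nat -> 'I_n) m w : has_portions (front_context loc m w) m.
Proof.
rewrite /has_portions /portions -/(portionsw _) portionsw_flatten -map_comp.
rewrite (_ : map _ _ = [seq [seq k <- iota 0 m | loc k == i] | i <- enum 'I_n]).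
  exact: perm_distribute.
by apply: eq_map => i /=; rewrite ffunE portionsw_cat portionsw_inl portionsw_inr cats0.
Qed.

Lemma words_eq_swap n (mu : move_rel n) (w w' : 'I_n -> seq endpoint) i s1 x y s2 :
  exchangeable mu x y -> valid (endpoints w) ->
  w i = s1 ++ x :: y :: s2 -> w' i = s1 ++ y :: x :: s2 ->
  (forall j, j != i -> w j = w' j) -> words_eq mu w w'.
Proof.
move=> exy vw wi wi' ww'.
pose C : template n :=
  [ffun c => if c == i then map inl s1 ++ inr 0 :: map inl s2 else map inl (w c)].
have pC : has_portions C 1.
  have h j : j != i -> portionsw (C j) = [::].
    by move=> /negbTE ji; rewrite ffunE ji portionsw_inl.
  have [r [h1 h2]] := perm_flatten_upd h.
  rewrite /has_portions /portions -/(portionsw _) portionsw_flatten -map_comp.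
  rewrite (permPl h1) /= ffunE eqxx portionsw_cat /= -!/(portionsw _) !portionsw_inl /=.
  rewrite perm_cons -(permPl h2); elim: (enum _) => //.
have fC u : forall c, fill C [:: u] c = if c == i then s1 ++ u ++ s2 else w c.
  move=> c; rewrite fillwE ffunE; case: eqP => _; last exact: fillw_inl.
  by rewrite -[inr 0 :: _]cat1s !fillw_cat !fillw_inl /fillw /= cats0.
apply: (@eq_words_eq _ _ (fill C [:: [:: x; y]]) (fill C [:: [:: y; x]])).
- by move=> c; rewrite fC; case: eqP => // ->.
- by move=> c; rewrite fC; case: eqP => [->//|/eqP ci]; rewrite ww'.
apply: exy => //; move: vw; congr (is_true (valid _)).
by apply: eq_endpoints => c; rewrite fC; case: eqP => // ->.
Qed.

(** Adjacent transpositions generate all rearrangements. *)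
Lemma perm_ind_swap (T : eqType) (Q : seq T -> seq T -> Prop) :
  (forall s, Q s s) -> (forall s1 s2 s3, Q s1 s2 -> Q s2 s3 -> Q s1 s3) ->
  (forall s1 x y s2, Q (s1 ++ x :: y :: s2) (s1 ++ y :: x :: s2)) ->
  forall s s', perm_eq s s' -> Q s s'.
Proof.
move=> Qr Qt Qs.
have Qfront p x s1 s2 : Q (p ++ s1 ++ x :: s2) (p ++ x :: s1 ++ s2).
  elim/last_ind: s1 s2 => [|s1 y IH] s2; first exact: Qr.
  rewrite !cat_rcons; apply: Qt (IH _).
  by have := Qs (p ++ s1) y x s2; rewrite -!catA.
suff H p s s' : perm_eq s s' -> Q (p ++ s) (p ++ s') by move=> s s'; apply: (H [::]).
elim: s' s p => [|x s' IH] s p; first by move/perm_nilP => ->; apply: Qr.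
move=> ss'; have xs : x \in s by rewrite (perm_mem ss') inE eqxx.
case/splitPr: xs ss' => s1 s2; rewrite -cat1s perm_catCA /= perm_cons => ss'.
apply: Qt (Qfront _ _ _ _) _; rewrite -!cat_rcons; exact: IH.
Qed.

(** One circle after the other. *)
Lemma words_eq_perm n (mu : move_rel n) (w w' : 'I_n -> seq endpoint) :
  all_exchangeable mu -> valid (endpoints w) ->
  (forall c, perm_eq (w c) (w' c)) -> words_eq mu w w'.
Proof.
move=> ex vw ww'.
pose upd (v : 'I_n -> seq endpoint) i s c := if c == i then s else v c.
have one (v : 'I_n -> seq endpoint) i s : perm_eq (v i) s -> valid (endpoints v) ->
    words_eq mu v (upd v i s).
  move=> pvs vv; pose Q s1 s2 := valid (endpoints (upd v i s1)) ->
    words_eq mu (upd v i s1) (upd v i s2).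
  have vE : upd v i (v i) =1 v by move=> c; rewrite /upd; case: eqP => // ->.
  apply: (eq_words_eq vE (fun _ => erefl)).
  suff QQ : Q (v i) s by apply: QQ; rewrite (eq_endpoints vE).
  apply: perm_ind_swap pvs => [s1|s1 s2 s3 h1 h2 v1|s1 x y s2 v1].
  - exact: words_eq_refl.
  - by have h := h1 v1; apply: words_eq_trans h (h2 (words_eq_validr h)).
  apply: (words_eq_swap (ex x y) v1 (i := i) (s1 := s1) (s2 := s2)); rewrite /upd ?eqxx //.
  by move=> j /negbTE ->.
have many (cs : seq 'I_n) : words_eq mu w (fun c => if c \in cs then w' c else w c).
  elim: cs => [|c cs IH]; first exact: words_eq_refl.
  apply: words_eq_trans IH _; set v := fun _ => _.
  have h : perm_eq (v c) (w' c) by rewrite /v; case: ifP.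
  have vv : valid (endpoints v).
    rewrite -(@perm_valid (endpoints w)) //; apply: perm_endpoints => j.
    by rewrite /v; case: ifP.
  apply: (eq_words_eq (fun _ => erefl) _ (one v c _ h vv)) => j.
  by rewrite /upd /v inE; case: eqP => [->|].
by apply: (eq_words_eq (fun _ => erefl) _ (many (enum 'I_n))) => c; rewrite mem_enum.
Qed.

Lemma flatten_uniq_inj (I : finType) (T : eqType) (f : I -> seq T) x i j :
  uniq (flatten [seq f i | i <- enum I]) -> x \in f i -> x \in f j -> i = j.
Proof.
move=> u xi xj; apply/eqP; apply: contraLR u => ij.
have ii : i \in enum I by rewrite mem_enum.
rewrite (perm_uniq (perm_flatten (perm_map _ (perm_to_rem ii)))) /= cat_uniq.
apply/negP => /and3P[_ /hasPn h _].
suff /h : x \in flatten [seq f k | k <- rem i (enum I)] by rewrite /= xi.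
apply/flattenP; exists (f j) => //; apply: map_f.
by rewrite (rem_filter _ (enum_uniq I)) mem_filter /= eq_sym ij mem_enum.
Qed.

Lemma uniq_flatten_sub (I : finType) (T : eqType) (f : I -> seq T) i :
  uniq (flatten [seq f i | i <- enum I]) -> uniq (f i).
Proof.
have ii : i \in enum I by rewrite mem_enum.
rewrite (perm_uniq (perm_flatten (perm_map _ (perm_to_rem ii)))) /= cat_uniq.
by case/and3P.
Qed.

(** The place of a letter that occurs once in a family of words is a function of
    the letter. *)
Lemma locate (I : finType) (T : eqType) (f : I -> seq T) (i0 : I) (s : seq T) :
  uniq s -> perm_eq s (flatten [seq f i | i <- enum I]) ->
  exists loc : T -> I, forall t, perm_eq t s ->
    forall i, perm_eq [seq x <- t | loc x == i] (f i).
Proof.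
move=> us sf; have uf : uniq (flatten [seq f i | i <- enum I]) by rewrite -(perm_uniq sf).
exists (fun x => odflt i0 [pick i | x \in f i]) => t ts i.
apply: uniq_perm; first by rewrite filter_uniq ?(perm_uniq ts).
  exact: uniq_flatten_sub uf.
move=> x; rewrite mem_filter (perm_mem ts) (perm_mem sf).
case: pickP => [j xj | none] /=.
  have xf : x \in flatten [seq f i | i <- enum I].
    by apply/flattenP; exists (f j) => //; apply: map_f; rewrite mem_enum.
  rewrite xf andbT; apply/eqP/idP => [<- //|xi]; exact: flatten_uniq_inj uf xj xi.
by rewrite none; apply/negbTE/negP => /andP[_ /flattenP[_ /mapP[j _ ->]]]; rewrite none.
Qed.

(** Up to the order of the endpoints on each circle, only the circles on which
    the portions lie matter. *)
Lemma context_front n (C : template n) m : 0 < n -> has_portions C m ->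
  exists (loc : nat -> 'I_n) (w : 'I_n -> seq endpoint),
    forall u, size u = m -> forall c, perm_eq (fill C u c) (fill (front_context loc m w) u c).
Proof.
move=> n0 pC.
have pC' : perm_eq (iota 0 m) (flatten [seq portionsw (C i) | i <- enum 'I_n]).
  by rewrite perm_sym; move: pC; rewrite /has_portions /portions -/(portionsw _) portionsw_flatten -map_comp.
have [loc locP] := locate (Ordinal n0) (iota_uniq 0 m) pC'.
exists loc, (fun c => basew (C c)) => u su c.
rewrite fill_front fillwE (permPl (perm_fillw _ _)) perm_catC perm_cat2r.
by apply/perm_flatten/perm_map; rewrite perm_sym locP.
Qed.

(** * Arrow lists *)

(** Each arrow comes with its source circle and its target circle. *)
Definition arrows n : Type := seq (arrow * ('I_n * 'I_n)).

Definition arrow_words n (l : arrows n) (c : 'I_n) : seq endpoint :=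
  flatten [seq (if x.2.1 == c then [:: tail_of x.1] else [::]) ++
               (if x.2.2 == c then [:: head_of x.1] else [::]) | x <- l].

Definition realizes n (w : 'I_n -> seq endpoint) (l : arrows n) : Prop :=
  forall c, perm_eq (w c) (arrow_words l c).

Definition distinct n (l : arrows n) : bool := uniq [seq x.1.1 | x <- l].

Lemma arrow_words_cat n (l l' : arrows n) c :
  arrow_words (l ++ l') c = arrow_words l c ++ arrow_words l' c.
Proof. by rewrite /arrow_words map_cat flatten_cat. Qed.

Lemma perm_arrow_words n (l l' : arrows n) c :
  perm_eq l l' -> perm_eq (arrow_words l c) (arrow_words l' c).
Proof. by move=> ll'; apply/perm_flatten/perm_map. Qed.

Lemma perm_single (I : finType) (T : eqType) (f : I -> seq T) i x :
  perm_eq (flatten [seq (if i == j then [:: x] else [::]) ++ f j | j <- enum I])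
          (x :: flatten [seq f j | j <- enum I]).
Proof.
have h j : j != i -> (if i == j then [:: x] else [::]) ++ f j = f j.
  by rewrite eq_sym => /negbTE ->.
have [r [h1 h2]] := perm_flatten_upd h.
by rewrite (permPl h1) eqxx /= perm_cons -(permPl h2).
Qed.

Lemma endpoints_arrow_words_cons n x (l : arrows n) :
  perm_eq (endpoints (arrow_words (x :: l)))
          (tail_of x.1 :: head_of x.1 :: endpoints (arrow_words l)).
Proof.
rewrite /endpoints (eq_map (_ : _ =1 fun c => (if x.2.1 == c then [:: tail_of x.1] else [::]) ++
   ((if x.2.2 == c then [:: head_of x.1] else [::]) ++ arrow_words l c))); last first.
  by move=> c; rewrite [LHS]/arrow_words /= -catA.
by rewrite (permPl (perm_single _ _ _)) perm_cons perm_single.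
Qed.

Lemma endpoints_nil n : endpoints (arrow_words ([::] : arrows n)) = [::].
Proof. by rewrite /endpoints; elim: (enum _). Qed.

Lemma names_arrow_words n (l : arrows n) :
  perm_eq (names (endpoints (arrow_words l))) [seq x.1.1 | x <- l].
Proof.
elim: l => [|x l IH]; first by rewrite endpoints_nil.
by rewrite (permPl (perm_names (endpoints_arrow_words_cons x l))) /names /= perm_cons.
Qed.

Lemma valid_arrow_words n (l : arrows n) : valid (endpoints (arrow_words l)) = distinct l.
Proof.
elim: l => [|x l IH]; first by rewrite endpoints_nil.
rewrite (perm_valid (endpoints_arrow_words_cons x l)) valid_arrow IH /distinct /=.
by rewrite (perm_mem (names_arrow_words l)).
Qed.

Lemma realizes_valid n (w : 'I_n -> seq endpoint) l : realizes w l ->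
  valid (endpoints w) = distinct l.
Proof. by move=> wl; rewrite -valid_arrow_words; apply/perm_valid/perm_endpoints. Qed.

Lemma uniq_map_inj_in (T U : eqType) (f : T -> U) s :
  uniq (map f s) -> {in s &, injective f}.
Proof.
elim: s => //= z s IH /andP[zs us] x y; rewrite !inE.
case/predU1P=> [->|xs] /predU1P[->|ys] fxy //; last exact: IH.
  by rewrite fxy map_f in zs.
by rewrite -fxy map_f in zs.
Qed.

Lemma tails_arrow_words n (l : arrows n) c :
  tails (arrow_words l c) = [seq x.1 | x <- l & x.2.1 == c].
Proof.
elim: l => //= x l IH; rewrite -[arrow_words (x :: l) c]/((_ ++ _) ++ arrow_words l c) !tails_cat IH.
by case: (x.2.1 == c); case: (x.2.2 == c).
Qed.

Lemma heads_arrow_words n (l : arrows n) c :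
  heads (arrow_words l c) = [seq x.1 | x <- l & x.2.2 == c].
Proof.
elim: l => //= x l IH; rewrite -[arrow_words (x :: l) c]/((_ ++ _) ++ arrow_words l c) !heads_cat IH.
by case: (x.2.1 == c); case: (x.2.2 == c).
Qed.

Lemma perm_tails_heads s t : perm_eq (tails s) (tails t) -> perm_eq (heads s) (heads t) ->
  perm_eq s t.
Proof.
have E r : perm_eq r (map tail_of (tails r) ++ map head_of (heads r)).
  have et : map tail_of (tails r) = [seq e <- r | e.1].
    by elim: r => // -[[] a] r; rewrite /tails /= => ->.
  have eh : map head_of (heads r) = filter (predC (fun e => e.1)) r.
    by elim: r {et} => // -[[] a] r; rewrite /heads /= => ->.
  by rewrite perm_sym et eh perm_filterC.
move=> tst hst; rewrite (permPl (E s)) (permPr (E t)).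
by apply: perm_cat; apply: perm_map.
Qed.

Lemma tails_endpoints n (w : 'I_n -> seq endpoint) :
  tails (endpoints w) = flatten [seq tails (w c) | c <- enum 'I_n].
Proof. by rewrite /endpoints; elim: (enum _) => //= i s IH; rewrite tails_cat IH. Qed.

Lemma heads_endpoints n (w : 'I_n -> seq endpoint) :
  heads (endpoints w) = flatten [seq heads (w c) | c <- enum 'I_n].
Proof. by rewrite /endpoints; elim: (enum _) => //= i s IH; rewrite heads_cat IH. Qed.

(** The circles of the two ends of an arrow are found by [locate], applied to
    the tails and to the heads. *)
Lemma realizable n (w : 'I_n -> seq endpoint) : 0 < n -> valid (endpoints w) ->
  exists l, realizes w l.
Proof.
move=> n0 /andP[/map_uniq ut bs].
have uh : uniq (heads (endpoints w)) by rewrite -(perm_uniq bs).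
have pt : perm_eq (tails (endpoints w)) (flatten [seq tails (w c) | c <- enum 'I_n]).
  by rewrite tails_endpoints.
have ph : perm_eq (heads (endpoints w)) (flatten [seq heads (w c) | c <- enum 'I_n]).
  by rewrite heads_endpoints.
have [src srcP] := locate (Ordinal n0) ut pt.
have [tgt tgtP] := locate (Ordinal n0) uh ph.
exists [seq (a, (src a, tgt a)) | a <- tails (endpoints w)] => c.
apply: perm_tails_heads; rewrite ?tails_arrow_words ?heads_arrow_words filter_map -map_comp /= map_id perm_sym.
  exact: srcP.
exact: tgtP.
Qed.

Lemma realizes_perm n (w : 'I_n -> seq endpoint) l l' :
  perm_eq l l' -> realizes w l -> realizes w l'.
Proof. by move=> ll' h c; apply: perm_trans (h c) (perm_arrow_words c ll'). Qed.

(** * Signed counts *)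

Definition arrow_data n : Type := seq (bool * ('I_n * 'I_n)).

Definition signed_ends n (l : arrows n) : arrow_data n := [seq (x.1.2, x.2) | x <- l].

(** The matrix of virtual linking numbers, with the self-arrows on its
    diagonal. *)
Definition lk n (t : arrow_data n) : 'M[int]_n :=
  (\sum_(x <- t) sgn x.1 *: delta_mx x.2.1 x.2.2)%R.

Lemma lk_entry n (t : arrow_data n) i j :
  lk t i j = (\sum_(x <- t | x.2 == (i, j)) sgn x.1)%R.
Proof.
rewrite /lk summxE [RHS]big_mkcond; apply: eq_bigr => -[s [p q]] _ /=.
rewrite !mxE xpair_eqE (eq_sym i) (eq_sym j).
by case: (p == i); case: (q == j); rewrite /= ?mulr1 ?mulr0.
Qed.

Lemma vlk_realizes n (D : gauss_diagram n) l i j : realizes D l ->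
  diagram_vlk D i j = lk (signed_ends l) i j.
Proof.
move=> Dl; have := diagram_valid D; rewrite (realizes_valid Dl) => ul.
rewrite /diagram_vlk (perm_big _ (perm_tails (Dl i))) tails_arrow_words big_map big_filter_cond.
rewrite lk_entry /signed_ends big_map big_seq_cond [RHS]big_seq_cond; apply: eq_bigl => x /=.
case: (boolP (x \in l)) => //= xl.
rewrite (perm_mem (perm_heads (Dl j))) heads_arrow_words; case: x xl => a [p q] /= xl.
rewrite xpair_eqE; congr andb; apply/mapP/idP => [[[b [p' q']]]|qj].
  rewrite mem_filter /= => /andP[q'j yl] ab; rewrite -ab in yl.
  by have [_ ->] := uniq_map_inj_in ul xl yl erefl.
by exists (a, (p, q)); rewrite // mem_filter qj.
Qed.

(** * Diagrams are determined by their lists of arrows *)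

Definition rename_arrows n (f : nat -> nat) (l : arrows n) : arrows n :=
  [seq ((f x.1.1, x.1.2), x.2) | x <- l].

Lemma arrow_words_rename n (f : nat -> nat) (l : arrows n) c :
  arrow_words (rename_arrows f l) c = map (rename f) (arrow_words l c).
Proof.
rewrite /arrow_words /rename_arrows -map_comp map_flatten -map_comp; congr flatten.
by apply: eq_map => -[a [p q]] /=; case: (p == c); case: (q == c).
Qed.

(** Outside [s], shift beyond all the names of [t]. *)
Lemma extend_renaming (s t : seq nat) : uniq s -> uniq t -> size s = size t ->
  exists2 f : nat -> nat, injective f & map f s = t.
Proof.
move=> us ut st; pose M := (\max_(x <- t) x).+1.
have tM x : x \in t -> x < M by move=> xt; rewrite ltnS leq_bigmax_seq.
pose f x := if x \in s then nth 0 t (index x s) else M + x.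
have fs x : x \in s -> f x \in t /\ index (f x) t = index x s.
  move=> xs; rewrite /f xs mem_nth -?st ?index_mem // index_uniq // -st index_mem //.
exists f.
  move=> x y; case: (boolP (x \in s)) => xs; case: (boolP (y \in s)) => ys fxy.
  - have [_ ix] := fs _ xs; have [_] := fs _ ys; rewrite -fxy ix => iy.
    by rewrite -(nth_index 0 xs) iy nth_index.
  - have [/tM] := fs _ xs; rewrite fxy /f (negbTE ys) => h; exfalso; clear -h; lia.
  - have [/tM] := fs _ ys; rewrite -fxy /f (negbTE xs) => h; exfalso; clear -h; lia.
  by move: fxy; rewrite /f (negbTE xs) (negbTE ys) => /addnI.
apply: (@eq_from_nth _ 0); rewrite ?size_map // => i si.
by rewrite (nth_map 0) // /f mem_nth // index_uniq.
Qed.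

Lemma perm_map_lift (T U : eqType) (f : T -> U) s t : perm_eq (map f s) t ->
  exists2 s', perm_eq s s' & map f s' = t.
Proof.
case: s => [|x0 s]; first by rewrite /= perm_sym => /perm_nilP ->; exists [::].
move=> h; have := h; rewrite perm_sym => /(perm_iotaP (f x0))[Is IsP ->].
exists (map (nth x0 (x0 :: s)) Is).
  rewrite size_map in IsP; rewrite perm_sym.
  by apply/(perm_iotaP x0); exists Is.
rewrite -map_comp; apply/eq_in_map => i; rewrite (perm_mem IsP) mem_iota add0n => hi.
have {}hi : i < size (x0 :: s) by move: hi; rewrite size_map.
by rewrite (nth_map x0).
Qed.

Lemma admits_isotopic n (mu : move_rel n) :
  admits mu (@isotopic n).
Proof. by move=> D D' h; apply: rst_step; left; apply: Or41. Qed.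

(** Rearranging the words takes care of the order of the endpoints, isotopy of the
    names. *)
Lemma words_eq_signed_ends n (mu : move_rel n) (w w' : 'I_n -> seq endpoint) l l' :
  all_exchangeable mu -> valid (endpoints w) -> valid (endpoints w') ->
  realizes w l -> realizes w' l' -> perm_eq (signed_ends l) (signed_ends l') -> words_eq mu w w'.
Proof.
move=> ex vw vw' wl wl' /perm_map_lift[l1 ll1 sl].
have {}wl := realizes_perm ll1 wl.
have ul : distinct l1 by rewrite -(realizes_valid wl).
have ul' : distinct l' by rewrite -(realizes_valid wl').
have sz : size l1 = size l' by rewrite -(size_map (fun x => (x.1.2, x.2)) l1) sl size_map.
have [|f injf fl] := extend_renaming ul ul'; first by rewrite !size_map.
have l'E : l' = rename_arrows f l1.
  move: sz sl fl; clear.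
  elim: l1 l' => [|[[k s] pq] l IH] [|[[k' s'] pq'] l'] //= [sz] [-> -> sl] [<- fl].
  by rewrite (IH l').
apply: words_eq_trans (words_eq_perm ex vw wl) _.
apply: words_eq_trans (_ : words_eq mu _ (arrow_words l')) _; last first.
  by apply: words_eq_sym; apply: words_eq_perm.
have [D hD] := diagram_of (etrans (valid_arrow_words l1) ul).
have [D' hD'] := diagram_of (etrans (valid_arrow_words l') ul').
exists D, D'; split=> //; apply: admits_isotopic; exists f, (fun _ => 0); split=> // i.
by rewrite rot0 hD hD' l'E arrow_words_rename.
Qed.

(** * Moves on lists of arrows *)
Lemma valid_drop s t : valid (s ++ t) -> balanced t -> valid s.
Proof.
rewrite /valid names_cat cat_uniq /balanced tails_cat heads_cat => /andP[/and3P[-> _ _] b] bt.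
have /permPr h : perm_eq (heads s ++ tails t) (heads s ++ heads t) by rewrite perm_cat2l.
by move: b; rewrite -h perm_cat2r.
Qed.

Lemma base_front n (loc : nat -> 'I_n) m w : base (front_context loc m w) = endpoints w.
Proof.
have basew_cat x y : basew (x ++ y) = basew x ++ basew y by exact: pmap_cat.
rewrite /base /endpoints; elim: (enum _) => //= c s IH.
rewrite basew_cat IH ffunE basew_cat; congr cat.
have -> : basew (map inr [seq k <- iota 0 m | loc k == c]) = [::] by elim: (filter _ _).
by elim: (w c) => //= e r ->.
Qed.

(** The arrows [l] are those drawn by the portions [u], whose places are given by
    [loc]. *)
Definition describes n (loc : nat -> 'I_n) (u : seq (seq endpoint)) (l : arrows n) : Prop :=
  forall c, perm_eq (placed loc (size u) u c) (arrow_words l c).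

Lemma realizes_front n (loc : nat -> 'I_n) w u l lu : describes loc u lu -> realizes w l ->
  realizes (fill (front_context loc (size u) w) u) (lu ++ l).
Proof. by move=> hu hl c; rewrite fill_front arrow_words_cat perm_cat. Qed.

(** The context itself is a valid diagram; [l] lists its arrows. *)
Lemma local_move_realizes n M (D D' : gauss_diagram n) : 0 < n ->
  (forall p q, M p q -> balanced (flatten p)) -> local_move M D D' ->
  exists p q (loc : nat -> 'I_n) l, [/\ M p q,
    forall lp, describes loc p lp -> realizes D (lp ++ l) &
    forall lq, describes loc q lq -> realizes D' (lq ++ l)].
Proof.
move=> n0 bM [C [p [q [Mpq spq pC hD hD']]]].
have [loc [w hw]] := context_front n0 pC.
have vw : valid (endpoints w).
  rewrite -(base_front loc (size p)); apply: (@valid_drop _ (flatten p)); last exact: bM Mpq.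
  rewrite -valid_fill ?front_portions // -(@perm_valid (endpoints D)) ?diagram_valid //.
  by apply: perm_endpoints => c; rewrite hD hw.
have [l wl] := realizable n0 vw.
exists p, q, loc, l; split=> // lu hu c.
  by rewrite hD (permPl (hw _ _ _)) //; apply: realizes_front.
by rewrite hD' (permPl (hw _ _ _)) ?spq //; apply: realizes_front.
Qed.

Lemma perm_move_realizes n M (D D' : gauss_diagram n) l :
  (forall p q, M p q -> forall k, perm_eq (nth [::] p k) (nth [::] q k)) ->
  local_move M D D' -> realizes D l -> realizes D' l.
Proof.
move=> pM [C [p [q [Mpq spq pC hD hD']]]] Dl c; apply: perm_trans (Dl c).
rewrite hD hD' !fillwE; elim: (C c) => // -[e|k] x IH; rewrite /fillw /=.
  by rewrite perm_cons.
by rewrite perm_cat // perm_sym (pM _ _ Mpq).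
Qed.

Lemma isotopic_realizes n (D D' : gauss_diagram n) l :
  isotopic D D' -> realizes D l -> exists2 l', realizes D' l' & signed_ends l' = signed_ends l.
Proof.
case=> f [r [_ h]] Dl; exists (rename_arrows f l).
  by move=> c; rewrite h perm_rot arrow_words_rename perm_map.
by rewrite /signed_ends -map_comp.
Qed.

(** * Equivalence of lists of arrows *)

Definition data_eq n (mu : move_rel n) (t t' : arrow_data n) : Prop :=
  forall (w w' : 'I_n -> seq endpoint) l l', valid (endpoints w) -> valid (endpoints w') ->
    realizes w l -> realizes w' l' ->
    perm_eq (signed_ends l) t -> perm_eq (signed_ends l') t' ->
    words_eq mu w w'.

Fixpoint label n (m : nat) (t : arrow_data n) : arrows n :=
  if t is x :: t' then ((m, x.1), x.2) :: label m.+1 t' else [::].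

Lemma signed_ends_label n m (t : arrow_data n) : signed_ends (label m t) = t.
Proof. by elim: t m => //= -[s pq] t IH m; rewrite IH. Qed.

Lemma names_label n m (t : arrow_data n) : [seq x.1.1 | x <- label m t] = iota m (size t).
Proof. by elim: t m => //= x t IH m; rewrite IH. Qed.

Lemma distinct_cat n m (l : arrows n) t : distinct l -> all (fun x => x.1.1 < m) l ->
  distinct (l ++ label m t).
Proof.
move=> ul /allP lm; rewrite /distinct map_cat names_label cat_uniq iota_uniq andbT.
rewrite [uniq _]ul; apply/hasPn => k; rewrite mem_iota => /andP[mk _].
by apply/negP => /mapP[x /lm xm kx]; move: mk; rewrite kx leqNgt xm.
Qed.

Lemma signed_ends_cat n (l l' : arrows n) :
  signed_ends (l ++ l') = signed_ends l ++ signed_ends l'.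
Proof. exact: map_cat. Qed.

(** One equivalence between realizations is enough. *)
Lemma data_eq_intro n (mu : move_rel n) (w w' : 'I_n -> seq endpoint) l l' :
  all_exchangeable mu -> realizes w l -> realizes w' l' -> words_eq mu w w' ->
  data_eq mu (signed_ends l) (signed_ends l').
Proof.
move=> ex wl wl' ww' v v' k k' vv vv' vk vk' kl kl'.
apply: (words_eq_trans (words_eq_signed_ends ex vv (words_eq_validl ww') vk wl kl)).
apply: (words_eq_trans ww'); apply: (words_eq_signed_ends ex (words_eq_validr ww') vv' wl' vk').
by rewrite perm_sym.
Qed.

Lemma data_eq_perm n (mu : move_rel n) (t t' : arrow_data n) :
  all_exchangeable mu -> perm_eq t t' -> data_eq mu t t'.
Proof.
move=> ex tt' w w' l l' vw vw' wl wl' lt lt'; apply: (words_eq_signed_ends ex vw vw' wl wl').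
by rewrite (permPl lt) (permPr lt').
Qed.

Lemma data_eq_sym n (mu : move_rel n) (t t' : arrow_data n) :
  data_eq mu t t' -> data_eq mu t' t.
Proof. by move=> h w w' l l' *; apply: words_eq_sym; apply: (h _ _ l' l). Qed.

Lemma data_eq_trans n (mu : move_rel n) (t1 t2 t3 : arrow_data n) :
  data_eq mu t1 t2 -> data_eq mu t2 t3 -> data_eq mu t1 t3.
Proof.
move=> h12 h23 w w' l l' vw vw' wl wl' lt lt'.
have v2 : valid (endpoints (arrow_words (label 0 t2))).
  by rewrite valid_arrow_words /distinct names_label iota_uniq.
have r2 : realizes (arrow_words (label 0 t2)) (label 0 t2) by move=> c.
have s2 : perm_eq (signed_ends (label 0 t2)) t2 by rewrite signed_ends_label.
exact: words_eq_trans (h12 _ _ _ _ vw v2 wl r2 lt s2) (h23 _ _ _ _ v2 vw' r2 wl' s2 lt').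
Qed.

Lemma data_eq_move n (mu : move_rel n) M p q (loc : nat -> 'I_n) lp lq m t :
  all_exchangeable mu -> admits mu (local_move M) -> M p q ->
  size p = size q -> describes loc p lp -> describes loc q lq ->
  distinct lp -> distinct lq -> all (fun x => x.1.1 < m) lp -> all (fun x => x.1.1 < m) lq ->
  data_eq mu (signed_ends lp ++ t) (signed_ends lq ++ t).
Proof.
move=> ex aM Mpq spq hp hq up uq mp mq.
have Wt : realizes (arrow_words (label m t)) (label m t) by move=> c.
have rp := realizes_front hp Wt; have rq := realizes_front hq Wt.
have := data_eq_intro ex rp rq; rewrite !signed_ends_cat signed_ends_label; apply.
have vp := etrans (realizes_valid rp) (distinct_cat t up mp).
have vq := etrans (realizes_valid rq) (distinct_cat t uq mq).
have [D hD] := diagram_of vp; have [D' hD'] := diagram_of vq.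
exists D, D'; split=> //; apply: aM.
exists (front_context loc (size p) (arrow_words (label m t))), p, q; split=> //; first exact: front_portions.
by rewrite spq.
Qed.

Lemma describes_R1 n (loc : nat -> 'I_n) a o :
  describes loc [:: ordered o (tail_of a) (head_of a)] [:: (a, (loc 0, loc 0))].
Proof.
move=> c; rewrite /placed /arrow_words /=; case: (loc 0 == c) => //=.
by case: o => /=; apply/permP => P /=; clear; lia.
Qed.

Lemma describes_R2 n (loc : nat -> 'I_n) a b o o' :
  describes loc [:: ordered o (tail_of a) (tail_of b); ordered o' (head_of a) (head_of b)]
    [:: (a, (loc 0, loc 1)); (b, (loc 0, loc 1))].
Proof.
move=> c; rewrite /placed /arrow_words /=; case: (loc 0 == c); case: (loc 1 == c) => //=.
all: by apply/permP => P; rewrite ?count_cat ?count_ordered /= ?count_cat ?count_ordered /=; clear; lia.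
Qed.

Lemma describes_arrow n (loc : nat -> 'I_n) a :
  describes loc [:: [:: tail_of a]; [:: head_of a]] [:: (a, (loc 0, loc 1))].
Proof.
move=> c; rewrite /placed /arrow_words /=; case: (loc 0 == c); case: (loc 1 == c) => //=.
all: by apply/permP => P /=; clear; lia.
Qed.

Lemma describes_reversed n (loc : nat -> 'I_n) a :
  describes loc [:: [:: head_of a]; [:: tail_of a]] [:: (a, (loc 1, loc 0))].
Proof.
move=> c; rewrite /placed /arrow_words /=; case: (loc 0 == c); case: (loc 1 == c) => //=.
all: by apply/permP => P /=; clear; lia.
Qed.

Lemma describes_nil n (loc : nat -> 'I_n) m : describes loc (nseq m [::]) ([::] : arrows n).
Proof.
move=> c; rewrite /placed size_nseq; elim: (filter _ _) => //= k s.
by rewrite nth_nseq; case: ifP.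
Qed.

Lemma describes_BP n (loc : nat -> 'I_n) (a13 a14 a23 a24 : arrow) e1 e2 e3 e4 :
  describes loc [:: ordered e1 (tail_of a13) (tail_of a14);
           ordered e2 (tail_of a23) (tail_of a24);
           ordered e3 (head_of a13) (head_of a23);
           ordered e4 (head_of a14) (head_of a24)]
   [:: (a13, (loc 0, loc 2)); (a14, (loc 0, loc 3));
       (a23, (loc 1, loc 2)); (a24, (loc 1, loc 3))].
Proof.
move=> c; rewrite /placed /arrow_words /=.
case: (loc 0 == c); case: (loc 1 == c); case: (loc 2 == c); case: (loc 3 == c) => //=.
all: by apply/permP => P; rewrite /= ?count_cat ?count_ordered /= ?count_cat ?count_ordered /=
  ?count_cat ?count_ordered /= ?count_cat ?count_ordered /=; clear; lia.
Qed.

Lemma describes_BP_reversed n (loc : nat -> 'I_n) (a13 a14 a23 a24 : arrow) e1 e2 e3 e4 :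
  describes loc [:: ordered e1 (head_of a13) (head_of a14);
           ordered e2 (head_of a23) (head_of a24);
           ordered e3 (tail_of a13) (tail_of a23);
           ordered e4 (tail_of a14) (tail_of a24)]
   [:: (a13, (loc 2, loc 0)); (a14, (loc 3, loc 0));
       (a23, (loc 2, loc 1)); (a24, (loc 3, loc 1))].
Proof.
move=> c; rewrite /placed /arrow_words /=.
case: (loc 0 == c); case: (loc 1 == c); case: (loc 2 == c); case: (loc 3 == c) => //=.
all: by apply/permP => P; rewrite /= ?count_cat ?count_ordered /= ?count_cat ?count_ordered /=
  ?count_cat ?count_ordered /= ?count_cat ?count_ordered /=; clear; lia.
Qed.

Lemma data_eq_R1 n (mu : move_rel n) s i t :
  all_exchangeable mu -> data_eq mu ((s, (i, i)) :: t) t.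
Proof.
move=> ex; apply: data_eq_sym.
pose a : arrow := (0, s).
exact: (@data_eq_move _ _ _ _ _ (fun _ => i) [::] [:: (a, (i, i))] 1 t ex (@admits_R1 n mu)
  (R1_intro a true) erefl (describes_nil _ 1) (@describes_R1 _ (fun _ => i) a true)).
Qed.

Lemma data_eq_R2 n (mu : move_rel n) s i j t :
  all_exchangeable mu -> data_eq mu ((s, (i, j)) :: (~~ s, (i, j)) :: t) t.
Proof.
move=> ex; apply: data_eq_sym.
pose a : arrow := (0, s); pose b : arrow := (1, ~~ s).
have ab : a.2 = ~~ b.2 by rewrite /= negbK.
pose loc := nth i [:: i; j].
exact: (@data_eq_move _ _ _ _ _ loc [::] [:: (a, (i, j)); (b, (i, j))] 2 t ex (@admits_R2 n mu)
  (R2_signs true true ab) erefl (describes_nil _ 2) (@describes_R2 _ loc a b true true)).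
Qed.

(** * Classification by virtual linking numbers *)

Local Open Scope ring_scope.

Lemma lk_cons n x (t : arrow_data n) : lk (x :: t) = sgn x.1 *: delta_mx x.2.1 x.2.2 + lk t.
Proof. by rewrite /lk big_cons. Qed.

Lemma lk_nil n : lk ([::] : arrow_data n) = 0.
Proof. by rewrite /lk big_nil. Qed.

Lemma lk_cat n (t t' : arrow_data n) : lk (t ++ t') = lk t + lk t'.
Proof. by rewrite /lk big_cat. Qed.

Lemma lk_perm n (t t' : arrow_data n) : perm_eq t t' -> lk t = lk t'.
Proof. by move=> tt'; rewrite /lk (perm_big _ tt'). Qed.

Definition negate n (t : arrow_data n) : arrow_data n := [seq (~~ x.1, x.2) | x <- t].

Lemma sgn_negb s : sgn (~~ s) = - sgn s.
Proof. by case: s. Qed.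

Lemma lk_negate n (t : arrow_data n) : lk (negate t) = - lk t.
Proof.
elim: t => [|x t IH]; first by rewrite lk_nil oppr0.
by rewrite /= !lk_cons IH /= sgn_negb scaleNr opprD.
Qed.

(** Off-diagonal entries only: the arrows from a circle to itself are
    invisible, since R1 removes them once endpoints can be exchanged. *)
Definition offdiag_eq n (A B : 'M[int]_n) : Prop := forall i j, i != j -> A i j = B i j.

(** If a linking number vanishes, the signs of its arrows cannot all agree. *)
Lemma lk_opposite n s (i j : 'I_n) (t : arrow_data n) :
  lk ((s, (i, j)) :: t) i j = 0 -> (~~ s, (i, j)) \in t.
Proof.
rewrite lk_cons !mxE !eqxx mulr1 /= => V0; apply: contra_eqT V0 => st.
have {st} : 0 <= sgn s * lk t i j.
  rewrite lk_entry mulr_sumr; rewrite big_seq_cond; apply: sumr_ge0 => -[s' [p q]] /=.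
  case/andP=> xt /eqP pq; rewrite pq in xt; case: s st xt; case: s' => //= st xt;
  by rewrite xt in st.
by case: s; rewrite /sgn; lia.
Qed.

(** Induction on the number of arrows: the first one is a self-arrow, which R1
    deletes, or it cancels by R2 with an arrow of the opposite sign. *)
Lemma data_eq_zero n (mu : move_rel n) (t t' : arrow_data n) :
  all_exchangeable mu -> offdiag_eq (lk t) 0 -> data_eq mu (t ++ t') t'.
Proof.
move=> ex; have [m] := ubnP (size t); elim: m t => // m IH [|[s [i j]] t] /= tm Vt.
  exact: data_eq_perm.
have [ij|ij] := eqVneq i j.
  rewrite ij; apply: data_eq_trans (@data_eq_R1 n mu s j (t ++ t') ex) _; apply: IH => // p q pq.
  rewrite -(Vt p q pq) lk_cons !mxE ij.
  have -> : (p == j) && (q == j) = false by apply: contraNF pq => /andP[/eqP-> /eqP->].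
  by rewrite mulr0 add0r.
have := Vt i j ij; rewrite mxE => /lk_opposite st.
have tE := perm_to_rem st; pose r := rem (~~ s, (i, j)) t.
have tE' : perm_eq ((s, (i, j)) :: t ++ t') ((s, (i, j)) :: (~~ s, (i, j)) :: r ++ t').
  by rewrite perm_cons -cat_cons perm_cat2r.
apply: data_eq_trans (data_eq_perm ex tE') _; apply: data_eq_trans (@data_eq_R2 n mu s i j (r ++ t') ex) _.
apply: IH => [|p q pq]; first by move: tm; rewrite (perm_size tE) /= => /ltnW.
by rewrite -(Vt p q pq) lk_cons (lk_perm tE) lk_cons !mxE /= sgn_negb mulNr addrA subrr add0r.
Qed.

(** The list made of [t], [t'] and [t'] with the opposite signs reduces to [t] if
    the last two are cancelled, and to [t'] if the outer ones are. *)
Lemma data_eq_lk n (mu : move_rel n) (t t' : arrow_data n) :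
  all_exchangeable mu -> offdiag_eq (lk t) (lk t') -> data_eq mu t t'.
Proof.
move=> ex tt'; apply: (@data_eq_trans _ _ _ ((t' ++ negate t') ++ t)).
  apply: data_eq_sym; apply: data_eq_zero => // i j _.
  by rewrite lk_cat lk_negate subrr.
apply: (@data_eq_trans _ _ _ ((t ++ negate t') ++ t')).
  by apply: data_eq_perm => //; apply/permP => P; rewrite !count_cat; clear; lia.
apply: data_eq_zero => // i j ij.
by rewrite lk_cat lk_negate !mxE (tt' _ _ ij) subrr.
Qed.

(** * Periods of the linking matrix *)

(** Adding a period to the linking numbers does not change the class; the diagonal
    is ignored throughout. *)
Definition period n (mu : move_rel n) (X : 'M[int]_n) : Prop :=
  forall t t', offdiag_eq (lk t') (lk t + X) -> data_eq mu t t'.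

Lemma lk_nseq n k s (i j : 'I_n) : lk (nseq k (s, (i, j))) = (sgn s *+ k) *: delta_mx i j.
Proof.
elim: k => [|k IH]; first by rewrite lk_nil mulr0n scale0r.
by rewrite [nseq _ _]/= lk_cons IH mulrS scalerDl.
Qed.

Lemma lk_surjective n (X : 'M[int]_n) : exists t, lk t = X.
Proof.
rewrite [X]matrix_sum_delta; pose P (Y : 'M[int]_n) := exists t, lk t = Y.
have P0 : P 0 by exists [::]; rewrite lk_nil.
have PD A B : P A -> P B -> P (A + B).
  by move=> [t <-] [t' <-]; exists (t ++ t'); rewrite lk_cat.
apply: (big_ind P) => // i _; apply: (big_ind P) => // j _.
exists (nseq `|X i j|%N (0 <= X i j, (i, j))); rewrite lk_nseq; congr (_ *: _).
by rewrite /sgn; case: (X i j) => k; rewrite ?NegzE /=; lia.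
Qed.

Lemma period_ext n (mu : move_rel n) X Y :
  offdiag_eq X Y -> period mu Y -> period mu X.
Proof. by move=> XY h t t' tt'; apply: h => i j ij; rewrite tt' // !mxE XY. Qed.

Lemma period_diag n (mu : move_rel n) :
  all_exchangeable mu -> period mu 0.
Proof. by move=> ex t t' tt'; apply: data_eq_lk => // i j ij; rewrite tt' // addr0. Qed.

Lemma periodD n (mu : move_rel n) X Y :
  period mu X -> period mu Y -> period mu (X + Y).
Proof.
move=> hX hY t t' tt'; have [t1 t1E] := lk_surjective (lk t + X).
apply: (@data_eq_trans _ _ _ t1); first by apply: hX => i j _; rewrite t1E.
by apply: hY => i j ij; rewrite tt' // t1E addrA.
Qed.

Lemma periodN n (mu : move_rel n) X :
  period mu X -> period mu (- X).
Proof.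
move=> hX t t' tt'; apply: data_eq_sym; apply: hX => i j ij.
by rewrite mxE tt' // !mxE subrK.
Qed.

Lemma periodZ n (mu : move_rel n) (z : int) X :
  all_exchangeable mu -> period mu X -> period mu (z *: X).
Proof.
move=> ex hX; have hn k : period mu (X *+ k).
  by elim: k => [|k IH]; [exact: period_diag | rewrite mulrS; apply: periodD].
rewrite -[z]intz scaler_int; case: z => k; first exact: hn.
by apply: periodN; apply: hn.
Qed.

Lemma period_lincomb n (mu : move_rel n)
    (Z : 'M[int]_n) (B : 'I_n -> 'I_n -> 'M[int]_n) :
  all_exchangeable mu -> (forall i j, period mu (B i j)) ->
  period mu (\sum_i \sum_j Z i j *: B i j).
Proof.
move=> ex hB; apply: (big_ind (period mu)) => [|A C|i _]; first exact: period_diag.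
  exact: periodD.
apply: (big_ind (period mu)) => [|A C|j _]; first exact: period_diag.
  exact: periodD.
exact: periodZ.
Qed.

(** A replacement of [p] by [q] applies to any list, since [p] can be created
    together with its negative. *)
Lemma period_rule n (mu : move_rel n) (p q : arrow_data n) :
  all_exchangeable mu -> (forall t, data_eq mu (p ++ t) (q ++ t)) -> period mu (lk q - lk p).
Proof.
move=> ex h t t' tt'; apply: (@data_eq_trans _ _ _ (p ++ (negate p ++ t))).
  by apply: data_eq_lk => // i j _; rewrite !lk_cat lk_negate addrA subrr add0r.
apply: data_eq_trans (h _) _; apply: data_eq_lk => // i j ij.
by rewrite tt' // !lk_cat lk_negate addrA (addrC _ (lk t)).
Qed.

Lemma sum_twisted n (e : int) (Z : 'M[int]_n) :
  \sum_i \sum_j Z i j *: (delta_mx i j + e *: delta_mx j i) = Z + e *: Z^T.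
Proof.
under eq_bigr => i _ do under eq_bigr => j _ do rewrite scalerDr.
under eq_bigr => i _ do rewrite big_split.
rewrite big_split -matrix_sum_delta /=; congr (_ + _).
rewrite {2}[Z]matrix_sum_delta raddf_sum scaler_sumr; apply: eq_bigr => i _.
rewrite raddf_sum scaler_sumr; apply: eq_bigr => j _.
by apply/matrixP => a b; rewrite !mxE andbC mulrCA.
Qed.

(** A matrix with X_ji = e X_ij is U + e U^T off the diagonal, with U its strictly
    upper triangular part. *)
Lemma period_twisted n (mu : move_rel n) (e : int) (X : 'M[int]_n) :
  all_exchangeable mu -> e * e = 1 ->
  (forall i j, period mu (delta_mx i j + e *: delta_mx j i)) ->
  (forall i j, i != j -> X j i = e * X i j) -> period mu X.
Proof.
move=> ex ee h hX; pose U : 'M[int]_n := \matrix_(i, j) (if (i < j)%N then X i j else 0).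
have pU := period_lincomb (Z := U) ex h; rewrite sum_twisted in pU.
apply: (period_ext _ pU) => i j ij; rewrite !mxE.
case: (ltngtP i j) => [_|_|/val_inj ij'].
- by rewrite mulr0 addr0.
- by rewrite add0r -hX // eq_sym.
by rewrite ij' eqxx in ij.
Qed.

Lemma period_VC n (mu : move_rel n) (X : 'M[int]_n) :
  all_exchangeable mu -> admits mu (@VC_move n) ->
  (forall i j, i != j -> X i j + X j i = 0) -> period mu X.
Proof.
move=> ex aM hX; apply: (@period_twisted _ _ (-1)) => // [i j|i j ij]; last first.
  by apply/eqP; rewrite mulN1r -addr_eq0 addrC hX.
pose a : arrow := (0%N, true); pose loc := nth i [:: j; i].
have := @period_rule n mu [:: (true, (j, i))] [:: (true, (i, j))] ex.
rewrite !lk_cons lk_nil !addr0 /= !scale1r scaleN1r; apply => t.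
exact: (@data_eq_move _ _ _ _ _ loc [:: (a, (j, i))] [:: (a, (i, j))] 1 t ex aM
  (VC_intro a) erefl (@describes_arrow _ loc a) (@describes_reversed _ loc a)).
Qed.

Lemma period_CC n (mu : move_rel n) (X : 'M[int]_n) :
  all_exchangeable mu -> admits mu (@CC_move n) ->
  (forall i j, i != j -> X i j - X j i = 0) -> period mu X.
Proof.
move=> ex aM hX; apply: (@period_twisted _ _ 1) => // [i j|i j ij]; last first.
  by apply/esym/eqP; rewrite mul1r -subr_eq0 hX.
pose a : arrow := (0%N, false); pose loc := nth i [:: j; i].
have := @period_rule n mu [:: (false, (j, i))] [:: (true, (i, j))] ex.
rewrite !lk_cons lk_nil !addr0 /= !scale1r scaleN1r opprK; apply => t.
exact: (@data_eq_move _ _ _ _ _ loc [:: (a, (j, i))] [:: (flip_sign a, (i, j))] 1 t ex aM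
  (CC_intro a) erefl (@describes_arrow _ loc a) (@describes_reversed _ loc (flip_sign a))).
Qed.

(** A band from circles [i1], [i2] to circles [i3], [i4]: the four arrows are
    reversed, and all but the last one change sign. *)
Lemma period_band n (mu : move_rel n) (i1 i2 i3 i4 : 'I_n) :
  all_exchangeable mu -> admits mu (@wBP_move n) ->
  period mu (- (delta_mx i3 i1 + delta_mx i4 i1 + delta_mx i3 i2 - delta_mx i4 i2)
             - (delta_mx i1 i3 + delta_mx i1 i4 + delta_mx i2 i3 + delta_mx i2 i4)).
Proof.
move=> ex aM; pose loc := nth i1 [:: i1; i2; i3; i4].
pose b13 : arrow := (0%N, false); pose b14 : arrow := (1%N, false).
pose b23 : arrow := (2%N, false); pose a24 : arrow := (3%N, true).
pose a13 := flip_sign b13; pose a14 := flip_sign b14; pose a23 := flip_sign b23.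
pose lp : arrows n := [:: (a13, (i1, i3)); (a14, (i1, i4)); (a23, (i2, i3)); (a24, (i2, i4))].
pose lq : arrows n := [:: (b13, (i3, i1)); (b14, (i4, i1)); (b23, (i3, i2)); (a24, (i4, i2))].
have := @period_rule n mu (signed_ends lp) (signed_ends lq) ex.
rewrite !lk_cons lk_nil !addr0 /= !scale1r !scaleN1r.
rewrite !opprD opprK -!addrA; apply => t.
have hp := @describes_BP _ loc a13 a14 a23 a24 true true true true.
have hr := @describes_BP_reversed _ loc b13 b14 b23 a24 true true true true.
have Wt : realizes (arrow_words (label 4 t)) (label 4 t) by move=> c.
have rp := realizes_front hp Wt; have rr := realizes_front hr Wt.
have := data_eq_intro ex rp rr; rewrite !signed_ends_cat signed_ends_label; apply.
have vp := etrans (realizes_valid rp) (@distinct_cat _ 4 lp t erefl erefl).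
have [m rm] := room_exists vp.
have [_ H] := @words_eq_wBP n mu _ m b13 b14 b23 a24 true true true true aM erefl erefl erefl
  (front_portions loc 4 (arrow_words (label 4 t))).
exact: H rm.
Qed.

Definition even_int (z : int) : Prop := z%:~R = 0 :> 'F_2.

Lemma even_intP z : even_int z -> exists y, z = 2 * y.
Proof.
move=> /eqP; rewrite -(dvdz_pcharf (pchar_Fp (isT : prime 2))) => /dvdzP[y ->].
by exists y; rewrite mulrC.
Qed.

Lemma even_intD x y : even_int x -> even_int y -> even_int (x + y).
Proof. by rewrite /even_int intrD => -> ->; rewrite addr0. Qed.

Lemma even_intN x : even_int x -> even_int (- x).
Proof. by rewrite /even_int mulrNz => ->; rewrite oppr0. Qed.

Lemma even_intM x y : even_int y -> even_int (x * y).
Proof. by rewrite /even_int intrM => ->; rewrite mulr0. Qed.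

Lemma even_int_sum (I : finType) (P : pred I) (f : I -> int) :
  (forall i, P i -> even_int (f i)) -> even_int (\sum_(i | P i) f i).
Proof. by move=> h; apply: (big_ind even_int) => // *; apply: even_intD. Qed.

(** The band with i1 = i2 = i3 has two arrows off the diagonal, parallel and of
    the same sign, which become opposite. *)
Lemma period_double n (mu : move_rel n) (X : 'M[int]_n) :
  all_exchangeable mu -> admits mu (@wBP_move n) ->
  (forall i j, i != j -> even_int (X i j)) -> period mu X.
Proof.
move=> ex aM hX; pose Y : 'M[int]_n := \matrix_(i, j) (X i j %/ 2)%Z.
have XY : offdiag_eq X (\sum_i \sum_j Y i j *: (2 *: delta_mx i j)).
  move=> i j ij; under eq_bigr => k _ do under eq_bigr => l _ do rewrite scalerA mulrC -scalerA.
  under eq_bigr => k _ do rewrite -scaler_sumr.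
  rewrite -scaler_sumr -matrix_sum_delta !mxE.
  by have [y ->] := even_intP (hX _ _ ij); rewrite mulKz.
apply: (period_ext XY); apply: period_lincomb => // i j.
apply: (period_ext _ (periodN (@period_band _ _ i i i j ex aM))) => p q pq.
have pii : (p == i) && (q == i) = false.
  by apply: contraNF pq => /andP[/eqP-> /eqP->].
by rewrite !mxE pii; lia.
Qed.

Lemma sum_delta_row n (a p q : 'I_n) :
  \sum_(k < n | k != a) (delta_mx p q : 'M[int]_n) a k = ((p == a) && (q != a))%:R.
Proof.
under eq_bigr => k _ do rewrite mxE eq_sym.
case: (p == a) => /=; last by rewrite big1.
have [qa|qa] := eqVneq q a; first by rewrite big1 // => k ka; rewrite qa (negbTE ka).
by rewrite (bigD1 q) //= eqxx big1 // => k /andP[_ /negbTE ->].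
Qed.

(** The symmetric matrix of the triangle i, j, z. *)
Definition triangle n (z i j : 'I_n) : 'M[int]_n :=
  delta_mx i j + delta_mx j i + (delta_mx i z + delta_mx z i) + (delta_mx z j + delta_mx j z).

(** The band with i2 = i4 = z; the arrow from z to itself does not count. *)
Lemma period_triangle n (mu : move_rel n) z i j :
  all_exchangeable mu -> admits mu (@wBP_move n) -> period mu (triangle z i j).
Proof.
move=> ex aM; apply: (period_ext _ (periodN (@period_band _ _ i z j z ex aM))) => p q pq.
by rewrite !mxE; lia.
Qed.

Lemma triangle_sym n (z i j : 'I_n) : (triangle z i j)^T = triangle z i j.
Proof.
rewrite /triangle !raddfD /= !trmx_delta; congr (_ + _ + _); exact: addrC.
Qed.

Lemma triangle_row n (z i j a : 'I_n) :
  even_int (\sum_(k < n | k != a) triangle z i j a k).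
Proof.
rewrite /triangle; under eq_bigr => k _ do rewrite ![(_ + _ : 'M_n) a k]mxE.
rewrite !big_split /= !sum_delta_row /even_int.
case: (i == a); case: (j == a); case: (z == a) => //=; exact/val_inj.
Qed.

(** The triangles through a vertex z remove the odd entries off the row and the
    column of z.  What is left there is even as well, because the row sums are
    even and the matrix is symmetric modulo 2. *)
Lemma period_wBP n (mu : move_rel n) (X : 'M[int]_n) :
  (0 < n)%N -> all_exchangeable mu -> admits mu (@wBP_move n) ->
  (forall i, even_int (\sum_(k < n | k != i) X i k)) ->
  (forall i j, i != j -> even_int (X i j + X j i)) -> period mu X.
Proof.
move=> n0 ex aM rowX symX; pose z := Ordinal n0.
pose U : 'M[int]_n := \matrix_(i, j) (if (i < j)%N then X i j else 0).
pose Y := \sum_i \sum_j U i j *: triangle z i j.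
have pY : period mu Y by apply: period_lincomb => // i j; apply: period_triangle.
have YE a b : Y a b = \sum_i \sum_j U i j * triangle z i j a b.
  by rewrite summxE; apply: eq_bigr => i _; rewrite summxE; apply: eq_bigr => j _; rewrite mxE.
have symY a b : Y a b = Y b a.
  rewrite !YE; apply: eq_bigr => i _; apply: eq_bigr => j _.
  by congr (_ * _); rewrite -{1}triangle_sym mxE.
have rowY a : even_int (\sum_(k < n | k != a) Y a k).
  under eq_bigr => k _ do rewrite YE.
  rewrite exchange_big; apply: even_int_sum => i _.
  rewrite exchange_big; apply: even_int_sum => j _.
  by rewrite -mulr_sumr; apply/even_intM/triangle_row.
have offY a b : a != z -> b != z -> Y a b = U a b + U b a.
  move=> az bz; have /matrixP/(_ a b) := sum_twisted 1 U.
  rewrite summxE !mxE mul1r => <-; rewrite YE; apply: eq_bigr => i _.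
  rewrite summxE; apply: eq_bigr => j _.
  rewrite !mxE mul1r (negbTE az) (negbTE bz) !andbF !addr0 /=.
  by [].
have offX a b : a != z -> b != z -> a != b -> even_int (X a b - Y a b).
  move=> az bz ab; rewrite offY // !mxE.
  case: (ltngtP a b) => [_|_|/val_inj ij]; last by rewrite ij eqxx in ab.
    by rewrite addr0 subrr.
  rewrite add0r (_ : _ - _ = X a b + X b a - 2 * X b a); last by lia.
  by apply: even_intD; [apply: symX | apply: even_intN; rewrite mulrC; apply: even_intM; exact/val_inj].
have colX a : a != z -> even_int (X a z - Y a z).
  move=> az; have hX := rowX a; have hY := rowY a; pose S M := \sum_(k < n | (k != a) && (k != z)) (M : 'M[int]_n) a k.
  have SE M : \sum_(k < n | k != a) (M : 'M[int]_n) a k = M a z + S M by rewrite (bigD1 z) // eq_sym.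
  rewrite !SE in hX hY.
  rewrite (_ : _ - _ = (X a z + S X) + (- (Y a z + S Y) + - (S X - S Y))); last by lia.
  apply: even_intD => //; apply: even_intD; apply: even_intN => //.
  rewrite /S -sumrB; apply: even_int_sum => k /andP[ka kz].
  by apply: offX; rewrite // eq_sym.
have allX a b : a != b -> even_int (X a b - Y a b).
  move=> ab; have [bz|bz] := eqVneq b z; first by rewrite bz in ab *; apply: colX.
  have [az|az] := eqVneq a z; last exact: offX.
  rewrite az in ab *; rewrite (_ : _ - _ = (X z b + X b z) + (- (X b z - Y b z) + - (2 * Y z b))).
    apply: even_intD; first exact: symX; apply: even_intD; apply: even_intN; first exact: colX.
    by rewrite mulrC; apply: even_intM; exact/val_inj.
  by rewrite (symY b); lia.
rewrite -(subrK Y X) addrC; apply: periodD => //; apply: period_double => // i j ij.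
by rewrite !mxE; apply: allX.
Qed.

(** * Invariance and classification *)
Lemma moves_eq_of_period n (mu : move_rel n) (D D' : gauss_diagram n) :
  (0 < n)%N -> period mu (\matrix_(i, j) (diagram_vlk D' i j - diagram_vlk D i j)) ->
  moves_eq mu D D'.
Proof.
move=> n0 pX; have [l Dl] := realizable n0 (diagram_valid D).
have [l' Dl'] := realizable n0 (diagram_valid D').
apply: (@words_eq_of _ mu _ _ D D') => //.
apply: (pX (signed_ends l) (signed_ends l') _ D D' l l'); rewrite ?diagram_valid //.
by move=> i j _; rewrite !mxE (vlk_realizes _ _ Dl) (vlk_realizes _ _ Dl') addrC subrK.
Qed.

(** The arrows outside the portions contribute the same amount before and after. *)
Lemma vlk_change n M (D D' : gauss_diagram n) : (0 < n)%N ->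
  (forall p q, M p q -> balanced (flatten p)) -> local_move M D D' ->
  exists p q (loc : nat -> 'I_n), M p q /\
    forall lp lq, describes loc p lp -> describes loc q lq ->
    forall i j, diagram_vlk D' i j =
      diagram_vlk D i j + (lk (signed_ends lq) i j - lk (signed_ends lp) i j).
Proof.
move=> n0 bM /(local_move_realizes n0 bM)[p [q [loc [l [Mpq hp hq]]]]].
exists p, q, loc; split=> // lp lq dp dq i j.
rewrite (vlk_realizes _ _ (hp _ dp)) (vlk_realizes _ _ (hq _ dq)).
by rewrite !signed_ends_cat !lk_cat !mxE [RHS]addrC addrA subrK.
Qed.

Lemma vlk_perm_move n M (D D' : gauss_diagram n) i j : (0 < n)%N ->
  (forall p q, M p q -> forall k, perm_eq (nth [::] p k) (nth [::] q k)) ->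
  local_move M D D' -> diagram_vlk D' i j = diagram_vlk D i j.
Proof.
move=> n0 pM MDD'; have [l Dl] := realizable n0 (diagram_valid D).
by rewrite (vlk_realizes _ _ Dl) (vlk_realizes _ _ (perm_move_realizes pM MDD' Dl)).
Qed.

Lemma vlk_F n (D D' : gauss_diagram n) i j : (0 < n)%N ->
  F_move D D' -> diagram_vlk D' i j = diagram_vlk D i j.
Proof.
move=> n0; apply: vlk_perm_move => // _ _ [a b _] [|k] /=; last by rewrite nth_nil.
exact: (perm_ordered true false).
Qed.

Lemma vlk_welded n (D D' : gauss_diagram n) i j : (0 < n)%N -> i != j ->
  welded_move D D' -> diagram_vlk D' i j = diagram_vlk D i j.
Proof.
move=> n0 ij [iso|r1|r2|[r3|oc]].
- have [l Dl] := realizable n0 (diagram_valid D).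
  have [l' Dl' ll'] := isotopic_realizes iso Dl.
  by rewrite (vlk_realizes _ _ Dl) (vlk_realizes _ _ Dl') ll'.
- have [|p [q [loc [[a o]]]]] := vlk_change n0 _ r1; first by move=> ? ? [].
  move/(_ _ _ (describes_nil loc 1) (describes_R1 loc a o)) => ->.
  rewrite lk_cons lk_nil !mxE /= addr0 subr0.
  have -> : (i == loc 0%N) && (j == loc 0%N) = false.
    by apply: contraNF ij => /andP[/eqP-> /eqP->].
  by rewrite mulr0 addr0.
- have [|p [q [loc [[a b o o' ab]]]]] := vlk_change n0 _ r2; first by move=> ? ? [].
  move/(_ _ _ (describes_nil loc 2) (describes_R2 loc a b o o')) => ->.
  by rewrite !lk_cons lk_nil !mxE /= ab; lia.
- apply: vlk_perm_move r3 => // _ _ [a12 a23 a13 e1 e2 e3 _ _] [|[|[|k]]] /=;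
  by rewrite ?nth_nil //; apply: perm_ordered.
apply: vlk_perm_move oc => // _ _ [a b] [|k] /=; last by rewrite nth_nil.
exact: (perm_ordered true false).
Qed.

Lemma vlk_VC n (D D' : gauss_diagram n) i j : (0 < n)%N -> VC_move D D' ->
  diagram_vlk D' i j + diagram_vlk D' j i = diagram_vlk D i j + diagram_vlk D j i.
Proof.
move=> n0 /(vlk_change n0)[|p [q [loc [[a]]]]].
  by move=> ? ? [?]; rewrite /balanced /= perm_refl.
move/(_ _ _ (describes_arrow loc a) (describes_reversed loc a)) => E; rewrite !E.
rewrite !lk_cons lk_nil !mxE /= -!(eq_sym (loc _)) !(andbC (loc 0%N == j)) !(andbC (loc 0%N == i)).
lia.
Qed.

Lemma vlk_CC n (D D' : gauss_diagram n) i j : (0 < n)%N -> CC_move D D' ->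
  diagram_vlk D' i j - diagram_vlk D' j i = diagram_vlk D i j - diagram_vlk D j i.
Proof.
move=> n0 /(vlk_change n0)[|p [q [loc [[a]]]]].
  by move=> ? ? [?]; rewrite /balanced /= perm_refl.
move/(_ _ _ (describes_arrow loc a) (describes_reversed loc (flip_sign a))) => E; rewrite !E.
rewrite !lk_cons lk_nil !mxE /= sgn_negb -!(eq_sym (loc _)) !(andbC (loc 0%N == j)) !(andbC (loc 0%N == i)).
lia.
Qed.

Lemma link_repr n (D : gauss_diagram n) L : link_of D = L -> welded_eq D (repr L).
Proof.
rewrite -[RHS]reprK => /eqmodP; rewrite /= => /asboolP.
by [].
Qed.

Definition diagram_star n (D : gauss_diagram n) (i : 'I_n) : int :=
  \sum_(k < n | k != i) diagram_vlk D i k.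

Definition parity_eq n (D D' : gauss_diagram n) : Prop :=
  (forall i, (diagram_star D i)%:~R = (diagram_star D' i)%:~R :> 'F_2) /\
  (forall i j, i != j -> (diagram_vlk D i j)%:~R + (diagram_vlk D j i)%:~R =
     (diagram_vlk D' i j)%:~R + (diagram_vlk D' j i)%:~R :> 'F_2).

Lemma parity_eq_change n (D D' : gauss_diagram n) (X : 'M[int]_n) :
  (forall i j, diagram_vlk D' i j = diagram_vlk D i j + X i j) ->
  (forall i, even_int (\sum_(k < n | k != i) X i k)) ->
  (forall i j, i != j -> even_int (X i j + X j i)) -> parity_eq D D'.
Proof.
move=> DX rowX symX; split=> [i|i j ij].
  rewrite /diagram_star; under [in RHS]eq_bigr => k _ do rewrite DX.
  by rewrite big_split /= intrD rowX addr0.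
by rewrite !DX -!intrD (addrACA _ (X i j)) [RHS]intrD symX // addr0.
Qed.

Lemma odd_sgn s : exists e, sgn s = 1 + 2 * e.
Proof. by case: s; [exists 0 | exists (- 1)]. Qed.

Lemma even_double x : even_int (2 * x).
Proof. by rewrite mulrC; apply: even_intM; exact/val_inj. Qed.

Lemma parity_SR n a (D D' : gauss_diagram n) : (0 < n)%N ->
  local_move (SR a) D D' -> parity_eq D D'.
Proof.
move=> n0 /(vlk_change n0)[|p [q [loc [[]]]]].
  by move=> ? ? []; rewrite /balanced /= perm_refl.
move/(_ _ _ (describes_arrow loc a) (describes_arrow loc (flip_sign a))) => E.
have ev i j : even_int ((lk (signed_ends [:: (flip_sign a, (loc 0%N, loc 1%N))]) -
      lk (signed_ends [:: (a, (loc 0%N, loc 1%N))])) i j).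
  rewrite !lk_cons lk_nil !addr0 /= sgn_negb !mxE mulNr.
  by rewrite (_ : - ?[x] - ?x = 2 * - ?x); [apply: even_double | lia].
apply: (parity_eq_change (X := lk _ - lk _)) => [i j|i|i j _].
- by rewrite E !mxE.
- by apply: even_int_sum => k _; apply: ev.
by apply: even_intD; apply: ev.
Qed.

(** Modulo 2, each of the four arrows contributes E_pq + E_qp to the change.  This
    is symmetric, and the row sums of the total are even because each of the four
    portions carries the ends of two arrows. *)
Lemma parity_BP n A (D D' : gauss_diagram n) : (0 < n)%N ->
  local_move (BP A) D D' -> parity_eq D D'.
Proof.
move=> n0 /(vlk_change n0)[|p [q [loc [[]]]]].
  move=> ? ? [? ? ? ? ? ? ? ? _ _ _]; apply/permP => P.
  rewrite /= /tails /heads !filter_cat !map_cat /ordered.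
  by do 4! case: ifP => _ /=; clear; lia.
move=> a13 a14 a23 a24 e1 e2 e3 e4 _ _ _ b13 b14 b23 b24.
move/(_ _ _ (describes_BP loc a13 a14 a23 a24 e1 e2 e3 e4)
  (describes_BP_reversed loc b13 b14 b23 b24 e1 e2 e3 e4)).
move: (loc 0%N) (loc 1%N) (loc 2%N) (loc 3%N) => i1 i2 i3 i4.
have [[x13 s13] [x14 s14]] := (odd_sgn a13.2, odd_sgn a14.2).
have [[x23 s23] [x24 s24]] := (odd_sgn a23.2, odd_sgn a24.2).
pose S (i j : 'I_n) : 'M[int]_n := delta_mx i j + delta_mx j i.
pose B := S i1 i3 + S i1 i4 + (S i2 i3 + S i2 i4).
pose Y := x13 *: S i1 i3 + x14 *: S i1 i4 + (x23 *: S i2 i3 + x24 *: S i2 i4).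
rewrite !lk_cons lk_nil !addr0 /= !sgn_negb s13 s14 s23 s24 => E.
have rowB a : even_int (\sum_(k < n | k != a) B a k).
  rewrite /B /S; under eq_bigr => k _ do rewrite ![(_ + _ : 'M_n) a k]mxE.
  rewrite !big_split /= !sum_delta_row /even_int.
  by case: (i1 == a); case: (i2 == a); case: (i3 == a); case: (i4 == a); apply/val_inj.
apply: (parity_eq_change (X := - B - 2 *: Y)) => [i j|i|i j ij].
- rewrite E; congr (_ + _); rewrite /B /Y /S !mxE; lia.
- rewrite (_ : \sum_(k < n | k != i) _ = - (\sum_(k < n | k != i) B i k) +
    - (2 * \sum_(k < n | k != i) Y i k)).
    by apply: even_intD; apply: even_intN => //; apply: even_double.
  by rewrite mulr_sumr -!sumrN -big_split; apply: eq_bigr => k _; rewrite !mxE.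
have SC a b : S a b i j = S a b j i.
  by rewrite !mxE addrC (andbC (i == a)) (andbC (i == b)).
rewrite /B /Y; move: S SC {B Y E rowB} => S SC; rewrite !mxE !SC.
rewrite (_ : ?[x] + ?x = 2 * ?x); [exact: even_double | lia].
Qed.

Lemma parity_wBP n (D D' : gauss_diagram n) : (0 < n)%N -> wBP_move D D' -> parity_eq D D'.
Proof.
move=> n0 [A [a [D1 [h1 _ h2]]]].
have [r1 s1] := parity_BP n0 h1; have [r2 s2] := parity_SR n0 h2.
by split=> [i|i j ij]; [rewrite r1 r2 | rewrite s1 ?s2].
Qed.

(** A function on diagrams that no move changes is an invariant of the links, and
    can be evaluated on any representative. *)
Lemma invariant_moves n (mu : move_rel n)
    (T : Type) (f : gauss_diagram n -> T) (L L' : welded_link n) :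
  (forall D D', welded_move D D' -> f D = f D') ->
  (forall D D', mu D D' -> f D = f D') ->
  equal_up_to mu L L' -> f (repr L) = f (repr L').
Proof.
move=> hw hmu [D [D' [DL DL' DD']]].
have fw E E' : welded_eq E E' -> f E = f E'.
  by elim=> [E1 E2 /hw|E1|E1 E2 _ ->|E1 E2 E3 _ -> _ ->].
rewrite -(fw _ _ (link_repr DL)) -(fw _ _ (link_repr DL')).
by elim: DD' => [E1 E2 [/hw|/hmu]|E1|E1 E2 _ ->|E1 E2 E3 _ -> _ ->].
Qed.

Lemma equal_up_to_repr n (mu : move_rel n) (L L' : welded_link n) :
  moves_eq mu (repr L) (repr L') -> equal_up_to mu L L'.
Proof. by move=> h; exists (repr L), (repr L'); split=> //; apply: reprK. Qed.

Lemma admits_self n (mu : move_rel n) : admits mu mu.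
Proof. by move=> D D' h; apply: rst_step; right. Qed.

Lemma classify n (mu : move_rel n) (L L' : welded_link n) :
  (0 < n)%N -> period mu (\matrix_(i, j) (vlk L' i j - vlk L i j)) -> equal_up_to mu L L'.
Proof. by move=> n0 h; apply/equal_up_to_repr/moves_eq_of_period. Qed.

Theorem theorem1 (n : nat) (hn : (1 <= n)%N) (L L' : welded_link n) :
  (equal_up_to (@F_move n) L L' <->
     (forall i j : 'I_n, i != j -> vlk L i j = vlk L' i j)) /\
  (equal_up_to (@VC_move n) L L' <->
     (forall i j : 'I_n, i != j ->
        vlk L i j + vlk L j i = vlk L' i j + vlk L' j i)) /\
  (equal_up_to (@CC_move n) L L' <->
     (forall i j : 'I_n, i != j ->
        vlk L i j - vlk L j i = vlk L' i j - vlk L' j i)) /\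
  (equal_up_to (@wBP_move n) L L' <->
     (forall i : 'I_n, vlk_star_mod L i = vlk_star_mod L' i) /\
     (forall i j : 'I_n, i != j ->
        vlk_mod L i j + vlk_mod L j i = vlk_mod L' i j + vlk_mod L' j i)).
Proof.
have welded i j : i != j -> forall D D' : gauss_diagram n, welded_move D D' ->
    diagram_vlk D i j = diagram_vlk D' i j.
  by move=> ij D D' h; rewrite (vlk_welded hn ij h).
have weldedC i j : i != j -> forall D D' : gauss_diagram n, welded_move D D' ->
    diagram_vlk D j i = diagram_vlk D' j i.
  by rewrite eq_sym; apply: welded.
split; [|split; [|split]]; split.
- move=> h i j ij; apply: (invariant_moves (f := fun D => diagram_vlk D i j) (welded i j ij) _ h).
  by move=> D D' F; rewrite (vlk_F _ _ hn F).
- move=> h; apply: classify => //.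
  have ex := exchange_all (exchange_F (@admits_self n (@F_move n))).
  apply: (period_ext _ (period_diag ex)) => i j ij.
  by rewrite !mxE h // subrr.
- move=> h i j ij; apply: (invariant_moves (f := fun D => diagram_vlk D i j + diagram_vlk D j i) _ _ h).
    by move=> D D' w; rewrite (welded _ _ ij _ _ w) (weldedC _ _ ij _ _ w).
  by move=> D D' m; rewrite (vlk_VC _ _ hn m).
- move=> h; apply: classify => //.
  have aM := @admits_self n (@VC_move n).
  have ex := exchange_all (exchange_reversal aM VC_intro (fun _ => erefl) (fun _ => erefl)).
  by apply: period_VC => // i j ij; rewrite !mxE; have := h i j ij; lia.
- move=> h i j ij; apply: (invariant_moves (f := fun D => diagram_vlk D i j - diagram_vlk D j i) _ _ h).
    by move=> D D' w; rewrite (welded _ _ ij _ _ w) (weldedC _ _ ij _ _ w).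
  by move=> D D' m; rewrite (vlk_CC _ _ hn m).
- move=> h; apply: classify => //.
  have aM := @admits_self n (@CC_move n).
  have ex := exchange_all (exchange_reversal aM CC_intro (fun _ => erefl) flip_signK).
  by apply: period_CC => // i j ij; rewrite !mxE; have := h i j ij; lia.
- move=> h; split=> [i|i j ij].
    apply: (invariant_moves (f := fun D => (diagram_star D i)%:~R : 'F_2) _ _ h) => D D' m.
      by congr (_%:~R); apply: eq_bigr => k ki; apply: welded m; rewrite eq_sym.
    by have [] := parity_wBP hn m.
  apply: (invariant_moves (f := fun D => (diagram_vlk D i j)%:~R + (diagram_vlk D j i)%:~R : 'F_2) _ _ h).
    by move=> D D' w; rewrite (welded _ _ ij _ _ w) (weldedC _ _ ij _ _ w).
  by move=> D D' m; have [_ ->] := parity_wBP hn m.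
move=> [hstar hsym]; apply: classify => //.
have aM := @admits_self n (@wBP_move n).
have ex := exchange_all (exchange_tails_heads (exchange_heads_wBP aM)).
apply: period_wBP => // [i|i j ij].
  have e := hstar i; rewrite /vlk_star_mod in e.
  rewrite /even_int; under eq_bigr => k _ do rewrite mxE.
  by rewrite sumrB intrB e subrr.
rewrite !mxE /even_int addrACA -opprD intrB.
have := hsym i j ij; rewrite /vlk_mod -!intrD => ->.
by rewrite subrr.
Qed.
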